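(* Let $\pi\colon A\to M$ be an affine bundle modeled on a vector bundle $\boldsymbol{V}\to M$, endowed with a (generally nonlinear) connection with connector $\kappa$ and projectors $P_H,P_V$, and let $D$ be its linearization, a covariant derivative on $\pi^*\tilde A\to A$. Then $D$ can be expressed in terms of vector fields on $A$ in the form $$D_U\sigma=\kappa\bigl([P_H(U),\bar\sigma^V]\bigr)+\kappa\bigl(T\sigma(P_V(U))\bigr)+P_H(U)\bigl(\langle e^0,\sigma\rangle\bigr)\,\mathbb{I},$$ for every $U\in\mathfrak{X}(A)$ and every $\sigma\in\operatorname{Sec}(\pi^*\tilde A)$, where $\bar\sigma=\sigma-\langle e^0,\sigma\rangle\mathbb{I}\in\operatorname{Sec}(\pi^*\boldsymbol{V})$.
   Context: All objects are $C^\infty$. Linearization on vector bundles. Let $p\colon E\to M$ be a vector bundle and $E_0\subset E$ an open subset with a connection on it, i.e. a vector bundle morphism $\xi^H\colon p^*TM|_{E_0}\to TE_0$ over $\mathrm{id}_{E_0}$ with $Tp(\xi^H(a,v))=v$. Let $\xi^V(a,b)=\frac{d}{ds}(a+sb)|_{s=0}$ be the vertical lift, $\sigma^V(a)=\xi^V(a,\sigma(a))$ for a section $\sigma$ of $p^*E$ (viewed as a map to $E$ over $p$), $\kappa$ the left inverse of $\xi^V$ with $\kappa\circ\xi^H=0$, $P_V=\xi^V\circ\kappa$, $P_H=\mathrm{id}-P_V$. The linearization is the covariant derivative on $p^*E\to E_0$ given by $D_U\sigma=\kappa([P_H(U),\sigma^V])+\kappa(T\sigma(P_V(U)))$, the last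 term at $a$ being the derivative of $\sigma$ restricted to the fibre through $a$ in the vertical direction $P_V(U)_a$. Affine bundles. $\pi\colon A\to M$ is an affine bundle of finite rank modeled on $\boldsymbol{V}\to M$. Let $\tilde\pi\colon\tilde A\to M$ be the vector bundle whose fibre $\tilde A_m$ is the linear dual of the space of affine functions on $A_m$; evaluation embeds $A\subset\tilde A$ fibrewise as an affine hyperplane and $\boldsymbol{V}\subset\tilde A$ as the parallel vector subbundle. There is a canonical fibrewise linear function $j\colon\tilde A\to\mathbb{R}$ (evaluation on the constant function $1$) with $A=j^{-1}(1)$ and $\boldsymbol{V}=j^{-1}(0)$; viewed as a section of the dual bundle $\tilde A^*$ (and, by pullback, of $\pi^*\tilde A^*$) it is denoted $e^0$, so $\langle e^0,\sigma\rangle=j\circ\sigma$. A connection on $A$ is a vector bundle morphism $\xi^H\colon\pi^*TM\to TA$ over $\mathrm{id}_A$ with $T\pi(\xi^H(a,v))=v$. The vertical lift is $\xi^V\colon\pi^*\boldsymbol{V}\to TA$, $\xi^V(a,b)=\frac{d}{ds}(a+sb)|_{s=0}$, and for $\eta\in\operatorname{Sec}(\pi^*\boldsymbol{V})$, $\eta^V(a)=\xi^V(a,\eta(a))$. The connector $\kappa\colon TA\to\pi^*\boldsymbol{V}$ is the left inverse of $\xi^V$ with $\kappa\circ\xi^H=0$; $P_V=\xi^V\circ\kappa$, $P_H=\mathrm{id}-P_V$. The homogeneous extension of the connection is the connection on $\tilde A\setminus\boldsymbol{V}$ given by $\xi^{\tilde H}(\lambda a,v)=T\mu_\lambda(\xi^H(a,v))$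 for $\lambda\in\mathbb{R}\setminus\{0\}$, $a\in A$, where $\mu_\lambda(z)=\lambda z$. Let $\tilde D$ be its linearization, a covariant derivative on $\tilde\pi^*\tilde A\to\tilde A\setminus\boldsymbol{V}$. The linearization $D$ of the connection on $A$ is the restriction (pullback by the inclusion $A\subset\tilde A\setminus\boldsymbol{V}$) of $\tilde D$ to $A$: a covariant derivative on $\pi^*\tilde A\to A$. Sections of $\pi^*\tilde A$ (resp. $\pi^*A$, $\pi^*\boldsymbol{V}$) are viewed as maps from $A$ to $\tilde A$ (resp. $A$, $\boldsymbol{V}$) over $\mathrm{id}_M$. The canonical section is $\mathbb{I}(a)=a$, a section of $\pi^*A\subset\pi^*\tilde A$. For a vertical vector field $W$ on $A$, $\kappa(T\sigma(W))$ denotes the section of $\pi^*\tilde A$ whose value at $a$ is the vector of $\tilde A_{\pi(a)}$ corresponding (under the canonical identification of vertical tangent vectors of the vector bundle $\tilde A$ with elements of the fibre) to $T_a\sigma(W_a)\in T_{\sigma(a)}\tilde A$, i.e. the derivative of $\sigma|_{A_{\pi(a)}}\colon A_{\pi(a)}\to\tilde A_{\pi(a)}$ in the direction $W_a$. *)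

(* Defs.v *)
From HB Require Import structures.
From mathcomp Require Import all_boot all_order all_algebra.
From mathcomp Require Import all_classical all_reals all_analysis.

Set Implicit Arguments.
Unset Strict Implicit.
Unset Printing Implicit Defensive.

Import Order.TTheory GRing.Theory Num.Theory numFieldNormedType.Exports.
Local Open Scope classical_set_scope.
Local Open Scope ring_scope.

Section SmoothNormed.
Context {R : realType} {X Y : normedModType R}.

Fixpoint differentiable_upto (k : nat) (O : set X) (f : X -> Y) : Prop :=
  if k is k'.+1 then
    (forall x, O x -> differentiable f x) /\
    (forall v, differentiable_upto k' O (fun x => 'D_v f x))
  else True.

(* C^oo on the open set O: iterated directional derivatives of all orders
   exist and are (Frechet) differentiable, hence continuous, on O. *)
Definition Cinfty_on (O : set X) (f : X -> Y) :=
  forall k, differentiable_upto k O f.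

End SmoothNormed.

Record chart (R : realType) (M : Type) (n : nat) := Chart {
  cdom : set M;
  cmap : M -> 'rV[R]_n;
  cinv : 'rV[R]_n -> M }.

Arguments cdom {R M n} c.
Arguments cmap {R M n} c.
Arguments cinv {R M n} c.

Record atlas (R : realType) (M : Type) := Atlas {
  mdim : nat;
  charts : set (chart R M mdim) }.

Arguments mdim {R M} a.
Arguments charts {R M} a.

Section Manifolds.
Context {R : realType}.

Definition mopen {M : Type} (sM : atlas R M) (W : set M) :=
  forall c, charts sM c -> open (cmap c @` (W `&` cdom c)).

Record manifold {M : Type} (sM : atlas R M) : Prop := {
  charts_cover : forall p, exists2 c, charts sM c & cdom c p;
  chart_cancel : forall c, charts sM c ->
    forall p, cdom c p -> cinv c (cmap c p) = p;
  chart_overlap_open : forall c1 c2, charts sM c1 -> charts sM c2 ->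
    open (cmap c1 @` (cdom c1 `&` cdom c2));
  chart_transition : forall c1 c2, charts sM c1 -> charts sM c2 ->
    Cinfty_on (cmap c1 @` (cdom c1 `&` cdom c2)) (cmap c2 \o cinv c1);
  manifold_hausdorff : forall p q : M, p <> q ->
    exists W1 W2, [/\ mopen sM W1, mopen sM W2, W1 p, W2 q & W1 `&` W2 = set0];
  manifold_second_countable : exists B : nat -> set M,
    (forall i, mopen sM (B i)) /\
    (forall W p, mopen sM W -> W p -> exists2 i, B i p & B i `<=` W) }.

(* f : M -> R is smooth on some neighbourhood of p; it may be arbitrary away
   from p, so such an f stands for a germ at p. *)
Definition smooth_at {M : Type} (sM : atlas R M) (p : M) (f : M -> R) :=
  exists c (O : set 'rV[R]_(mdim sM)),
    [/\ charts sM c /\ cdom c p, open O, O (cmap c p),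
        O `<=` cmap c @` cdom c & Cinfty_on O (f \o cinv c)].

(* F pulls smooth germs back to smooth germs. Continuity of F is implied:
   apply this to the function equal to 0 on a neighbourhood of F p and to 1
   elsewhere. *)
Definition smooth_map_on {M N : Type} (sM : atlas R M) (sN : atlas R N)
    (W : set M) (F : M -> N) :=
  forall p, W p -> forall g, smooth_at sN (F p) g -> smooth_at sM p (g \o F).

Definition euclidean (r : nat) : atlas R 'rV[R]_r :=
  Atlas [set Chart setT id id].

Definition prod_chart {M N : Type} {m n : nat} (c : chart R M m)
    (d : chart R N n) : chart R (M * N) (m + n) :=
  Chart (cdom c `*` cdom d)
    (fun p => row_mx (cmap c p.1) (cmap d p.2))
    (fun y => (cinv c (lsubmx y), cinv d (rsubmx y))).

Definition prod_atlas {M N : Type} (sM : atlas R M) (sN : atlas R N) :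
    atlas R (M * N) :=
  Atlas [set e | exists c d, [/\ charts sM c, charts sN d & e = prod_chart c d]].

(* Tangent vectors at p are the derivations at p of the algebra of germs of
   smooth functions. They are represented by functionals on all functions
   M -> R, normalised to vanish on functions that are not smooth at p, so that
   equality of tangent vectors is Leibniz equality. (Two functions with the
   same germ at p automatically get the same value.) *)
Definition tvector (S : realType) (M : Type) := (M -> S) -> S.

Definition on_germs {M : Type} (sM : atlas R M) (p : M) (v : tvector R M) :
    tvector R M :=
  fun f => if `[< smooth_at sM p f >] then v f else 0.

Record tangent {M : Type} (sM : atlas R M) (p : M) (v : tvector R M) : Prop := {
  tangent_linear : forall (k : R) f g, smooth_at sM p f -> smooth_at sM p g ->
    v (k *: f + g) = k * v f + v g;
  tangent_leibniz : forall f g, smooth_at sM p f -> smooth_at sM p g ->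
    v (f \* g) = f p * v g + g p * v f;
  tangent_germ : forall f, ~ smooth_at sM p f -> v f = 0 }.

Definition pushforward {M N : Type} (sN : atlas R N) (F : M -> N) (p : M)
    (v : tvector R M) : tvector R N :=
  on_germs sN (F p) (fun g => v (g \o F)).

(* Smooth sections over W of the pullback F^*TN. *)
Definition vfield_along {M N : Type} (sM : atlas R M) (sN : atlas R N)
    (F : M -> N) (W : set M) (Y : M -> tvector R N) :=
  forall p, W p -> tangent sN (F p) (Y p) /\
    forall g, smooth_at sN (F p) g -> smooth_at sM p (fun q => Y q g).

Definition vfield {M : Type} (sM : atlas R M) (W : set M) (Y : M -> tvector R M) :=
  vfield_along sM sM id W Y.

Definition bracket {M : Type} (sM : atlas R M) (X Y : M -> tvector R M) :
    M -> tvector R M :=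
  fun p => on_germs sM p
    (fun f => X p (fun q => Y q f) - Y p (fun q => X q f)).

End Manifolds.

Record affineSpace (R : realType) (V : lmodType R) := AffineSpace {
  apoint :> Type;
  translate : apoint -> V -> apoint;
  translate0 : forall a, translate a 0 = a;
  translateD : forall a u v, translate (translate a u) v = translate a (u + v);
  translate_simply_transitive : forall a b, exists! v, translate a v = b }.

Definition is_affine (R : realType) (V : lmodType R) (P : affineSpace V)
    (f : P -> R) :=
  exists2 l : V -> R^o, linear l & forall a v, f (translate a v) = f a + l v.

Definition affine_pred (R : realType) (V : lmodType R) (P : affineSpace V) :
    {pred (P -> R)} := fun f => `[< is_affine f >].

Lemma affine_submod_closed (R : realType) (V : lmodType R)
  (P : affineSpace V) : submod_closed (@affine_pred R V P).
Proof.
split.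
  apply/asboolP; exists (fun=> 0); last by move=> a v; rewrite addr0.
  by move=> k u v; rewrite scaler0 addr0.
move=> k f g /asboolP[l ll fl] /asboolP[l' ll' gl].
apply/asboolP; exists (fun v => k *: l v + l' v).
  by move=> t u v; rewrite ll ll' !scalerDr !scalerA addrACA (mulrC k).
by move=> a v; rewrite !fctE fl gl scalerDr addrACA.
Qed.

HB.instance Definition _ (R : realType) (V : lmodType R) (P : affineSpace V) :=
  GRing.isSubmodClosed.Build R (P -> R) (@affine_pred R V P)
    (@affine_submod_closed R V P).

Record affine_fun (R : realType) (V : lmodType R) (P : affineSpace V) :=
  AffineFun { afun :> P -> R; _ : afun \in @affine_pred R V P }.

HB.instance Definition _ (R : realType) (V : lmodType R) (P : affineSpace V) :=
  [isSub for @afun R V P].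
HB.instance Definition _ (R : realType) (V : lmodType R) (P : affineSpace V) :=
  [Choice of @affine_fun R V P by <:].
HB.instance Definition _ (R : realType) (V : lmodType R) (P : affineSpace V) :=
  [SubChoice_isSubLmodule of @affine_fun R V P by <:].

Definition linear_pred (R : realType) (X : lmodType R) : {pred (X -> R)} :=
  fun z => `[< linear (z : X -> R^o) >].

Lemma linear_submod_closed (R : realType) (X : lmodType R) :
  submod_closed (@linear_pred R X).
Proof.
split; first by apply/asboolP=> k u v; rewrite scaler0 addr0.
move=> k f g /asboolP lf /asboolP lg; apply/asboolP=> t u v.
by rewrite !fctE lf lg !scalerDr !scalerA addrACA (mulrC k).
Qed.

HB.instance Definition _ (R : realType) (X : lmodType R) :=
  GRing.isSubmodClosed.Build R (X -> R) (@linear_pred R X)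
    (@linear_submod_closed R X).

Record linear_dual (R : realType) (X : lmodType R) :=
  LinearDual { dfun :> X -> R; _ : dfun \in @linear_pred R X }.

HB.instance Definition _ (R : realType) (X : lmodType R) :=
  [isSub for @dfun R X].
HB.instance Definition _ (R : realType) (X : lmodType R) :=
  [Choice of @linear_dual R X by <:].
HB.instance Definition _ (R : realType) (X : lmodType R) :=
  [SubChoice_isSubLmodule of @linear_dual R X by <:].

Section AffineHull.
Context {R : realType} {V : lmodType R} (P : affineSpace V).

Definition ahull : lmodType R := linear_dual (affine_fun P).

Lemma eval_linear (a : P) :
  (fun f : affine_fun P => f a) \in @linear_pred R (affine_fun P).
Proof. by apply/asboolP. Qed.

Definition eval_at (a : P) : ahull := LinearDual (eval_linear a).

Lemma affine_one_subproof : (fun=> 1) \in @affine_pred R V P.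
Proof.
apply/asboolP; exists (fun=> 0); last by move=> a v; rewrite addr0.
by move=> k u v; rewrite scaler0 addr0.
Qed.

Definition affine_one : affine_fun P := AffineFun affine_one_subproof.

(* The function j on A~, i.e. the pairing with e^0. *)
Definition ahull_height (z : ahull) : R := z affine_one.

(* The inclusion of V into the affine hull; it does not depend on the
   auxiliary point a, as affine functions satisfy f (a + v) - f a = l v. *)
Definition vincl (a : P) (v : V) : ahull := eval_at (translate a v) - eval_at a.

End AffineHull.

Section Bundles.
Context {R : realType} {M : Type} (sM : atlas R M).

(* Smooth sections over W of the pullback pi^*F. *)
Definition smooth_section {N : Type} (sN : atlas R N) (F : M -> Type)
    (sF : atlas R {m : M & F m}) (pi : N -> M) (W : set N)
    (s : forall q, F (pi q)) :=
  smooth_map_on sN sF W (fun q => existT F (pi q) (s q)).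

(* c and c' are mutually inverse fibre coordinates of F over U, giving a
   diffeomorphism of F|_U with U x R^r. *)
Definition trivialization (F : M -> Type) (sF : atlas R {m : M & F m})
    (r : nat) (U : set M) (c : forall m, F m -> 'rV[R]_r)
    (c' : forall m, 'rV[R]_r -> F m) :=
  [/\ mopen sM U,
      forall m, U m -> cancel (@c m) (@c' m) /\ cancel (@c' m) (@c m),
      smooth_map_on sF (prod_atlas sM (euclidean r))
        [set z | U (projT1 z)] (fun z => (projT1 z, c _ (projT2 z))) &
      smooth_map_on (prod_atlas sM (euclidean r)) sF
        [set q | U q.1] (fun q => existT F q.1 (c' q.1 q.2))].

Definition vector_bundle (E : M -> lmodType R) (sE : atlas R {m : M & E m}) :=
  manifold sE /\ exists r, forall m0, exists U
    (c : forall m, E m -> 'rV[R]_r) (c' : forall m, 'rV[R]_r -> E m),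
    [/\ U m0, trivialization sE U c c' & forall m, U m -> linear (@c m)].

Definition affine_bundle (V : M -> lmodType R) (sV : atlas R {m : M & V m})
    (A : forall m, affineSpace (V m)) (sA : atlas R {m : M & A m}) :=
  [/\ vector_bundle sV, manifold sA & exists r, forall m0, exists U
    (c : forall m, A m -> 'rV[R]_r) (c' : forall m, 'rV[R]_r -> A m)
    (l : forall m, V m -> 'rV[R]_r) (l' : forall m, 'rV[R]_r -> V m),
    [/\ U m0, trivialization sA U c c', trivialization sV U l l',
        forall m, U m -> linear (@l m) &
        forall m, U m -> forall (a : A m) v, c m (translate a v) = c m a + l m v]].

End Bundles.

Section Connections.
Context {R : realType} {M : Type} (sM : atlas R M).
(* A bundle F whose fibres are acted on by those of V: either an affine bundle
   modelled on V, or V itself with vector addition. *)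
Context {F : M -> Type} {V : M -> lmodType R} (add : forall m, F m -> V m -> F m).
Context (sF : atlas R {m : M & F m}).
Local Notation total := {m : M & F m}.
Local Notation proj := (@projT1 M F).

Definition vlift (a : total) (b : V (proj a)) : tvector R total :=
  on_germs sF a (fun f =>
    derive1 (fun s : R => f (existT F (proj a) (add (projT2 a) (s *: b)))) 0).

(* A horizontal lift xiH : pi^*TM -> TF over the open set F0 of the total space.
   Smoothness of this vector bundle morphism is expressed on local sections. *)
Record connection (F0 : set total)
    (xiH : total -> tvector R M -> tvector R total) : Prop := {
  connection_open : mopen sF F0;
  connection_tangent : forall a v, F0 a -> tangent sM (proj a) v ->
    tangent sF a (xiH a v);
  connection_linear : forall a (k : R) v w, F0 a ->
    tangent sM (proj a) v -> tangent sM (proj a) w ->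
    xiH a (k *: v + w) = k *: xiH a v + xiH a w;
  connection_lift : forall a v, F0 a -> tangent sM (proj a) v ->
    pushforward sM proj a (xiH a v) = v;
  connection_smooth : forall W Y, mopen sF W -> W `<=` F0 ->
    vfield_along sF sM proj W Y -> vfield sF W (fun a => xiH a (Y a)) }.

Record connector (F0 : set total) (xiH : total -> tvector R M -> tvector R total)
    (kappa : forall a : total, tvector R total -> V (proj a)) : Prop := {
  connector_linear : forall a (k : R) u w, F0 a ->
    tangent sF a u -> tangent sF a w ->
    kappa a (k *: u + w) = k *: kappa a u + kappa a w;
  connector_vert : forall a b, F0 a -> kappa a (vlift b) = b;
  connector_hor : forall a v, F0 a -> tangent sM (proj a) v ->
    kappa a (xiH a v) = 0 }.

Variable kappa : forall a : total, tvector R total -> V (proj a).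

Definition projV (X : total -> tvector R total) : total -> tvector R total :=
  fun a => vlift (kappa a (X a)).

Definition projH (X : total -> tvector R total) : total -> tvector R total :=
  fun a => X a - projV X a.

Definition section_vlift (s : forall a : total, V (proj a)) :
    total -> tvector R total := fun a => vlift (s a).

End Connections.

Definition vadd {R : realType} {M : Type} (E : M -> lmodType R) (m : M)
  (x y : E m) : E m := x + y.
Arguments vadd {R M} E m x y : simpl never.

Section Linearization.
Context {R : realType} {M : Type} (E : M -> lmodType R)
  (sE : atlas R {m : M & E m}).
Local Notation total := {m : M & E m}.

(* The element of the fibre through z identified with the vertical tangent
   vector w at z. *)
Definition vertical_value (z : total) (w : tvector R total) : E (projT1 z) :=
  xget 0 [set b | vlift (vadd E) sE (a := z) b = w].

(* The value at q of kappa(T s(X)), for a section s of pi^*E and a vertical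
   vector field X. *)
Definition fibre_derivative {N : Type} (pi : N -> M)
    (s : forall q, E (pi q)) (X : N -> tvector R N) (q : N) : E (pi q) :=
  vertical_value (existT (fun m => E m) (pi q) (s q))
    (pushforward sE (fun q => existT (fun m => E m) (pi q) (s q)) q (X q)).

(* The linearization of a connection on an open part of E with connector
   kappa; only germs at z (in that open part) are used. *)
Definition linearization (kappa : forall z : total, tvector R total -> E (projT1 z))
    (U : total -> tvector R total) (s : forall z : total, E (projT1 z))
    (z : total) : E (projT1 z) :=
  kappa z (bracket sE (projH (vadd E) sE kappa U)
                      (section_vlift (vadd E) sE s) z)
  + fibre_derivative (pi := @projT1 M (fun m => E m)) s
      (projV (vadd E) sE kappa U) z.

Record covariant_derivative {N : Type} (sN : atlas R N) (pi : N -> M)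
    (D : (N -> tvector R N) -> (forall q, E (pi q)) -> forall q, E (pi q)) : Prop := {
  covd_smooth : forall U s, vfield sN setT U -> smooth_section sN sE setT s ->
    smooth_section sN sE setT (D U s);
  covd_addl : forall U U' s, vfield sN setT U -> vfield sN setT U' ->
    smooth_section sN sE setT s ->
    forall q, D (fun p => U p + U' p) s q = D U s q + D U' s q;
  covd_scalel : forall (f : N -> R) U s, (forall p, smooth_at sN p f) ->
    vfield sN setT U -> smooth_section sN sE setT s ->
    forall q, D (fun p => f p *: U p) s q = f q *: D U s q;
  covd_addr : forall U s s', vfield sN setT U ->
    smooth_section sN sE setT s -> smooth_section sN sE setT s' ->
    forall q, D U (fun p => s p + s' p) q = D U s q + D U s' q;
  covd_leibniz : forall (f : N -> R) U s, (forall p, smooth_at sN p f) ->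
    vfield sN setT U -> smooth_section sN sE setT s ->
    forall q, D U (fun p => f p *: s p) q = U q f *: s q + f q *: D U s q }.

End Linearization.

Definition fibre_translate {R : realType} {M : Type} {V : M -> lmodType R}
  (A : forall m, affineSpace (V m)) (m : M) (a : A m) (v : V m) : A m :=
  translate a v.
Arguments fibre_translate {R M V} A m a v : simpl never.

Section AffineConnection.
Context {R : realType} {M : Type} {V : M -> lmodType R}
  {A : forall m, affineSpace (V m)}.
Context (sA : atlas R {m : M & A m}) (sAt : atlas R {m : M & ahull (A m)}).
Local Notation Atot := {m : M & A m}.
Local Notation Ahull := {m : M & ahull (A m)}.

(* The inclusion of A into A~ followed by multiplication by k. *)
Definition scaled_embedding (k : R) (a : Atot) : Ahull :=
  existT (fun m => ahull (A m)) (projT1 a) (k *: eval_at (projT2 a)).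

Definition hull_embedding (a : Atot) : Ahull :=
  existT (fun m => ahull (A m)) (projT1 a) (eval_at (projT2 a)).

(* The vector bundle structure of A~, as the dual of the bundle of affine
   functions: A -> A~ is smooth, and pairing with a smooth fibrewise affine
   function is smooth. Either clause determines the structure. *)
Record canonical_hull (sM : atlas R M) : Prop := {
  hull_vector_bundle : vector_bundle sM sAt;
  hull_embedding_smooth : smooth_map_on sA sAt setT hull_embedding;
  hull_pairing_smooth : forall (O : set M) (g : forall m, affine_fun (A m)),
    mopen sM O ->
    (forall a : Atot, O (projT1 a) ->
       smooth_at sA a (fun a' => g (projT1 a') (projT2 a'))) ->
    forall z : Ahull, O (projT1 z) ->
       smooth_at sAt z (fun z' => projT2 z' (g (projT1 z'))) }.

(* A~ \ V, where A~ is the bundle with fibres ahull (A m) *)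
Definition hull_complement : set Ahull :=
  [set z | ahull_height (projT2 z) != 0].

Definition homogeneous_extension (sM : atlas R M)
    (xiH : Atot -> tvector R M -> tvector R Atot)
    (xit : Ahull -> tvector R M -> tvector R Ahull) :=
  forall (k : R) (a : Atot) (v : tvector R M), k != 0 -> tangent sM (projT1 a) v ->
    xit (scaled_embedding k a) v
    = pushforward sAt (scaled_embedding k) a (xiH a v).

(* D is the pullback along A -> A~ \ V of the covariant derivative Dt, where Dt
   is the linearization of the extended connection (with connector kappat):
   (D_U s)(a) = (Dt_W t)(a) for W, t defined near a in A~ \ V, with W(a) = U(a)
   and t extending s. *)
Definition affine_linearization
    (kappat : forall z : Ahull, tvector R Ahull -> ahull (A (projT1 z)))
    (D : (Atot -> tvector R Atot) -> (forall a : Atot, ahull (A (projT1 a))) ->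
         forall a : Atot, ahull (A (projT1 a))) :=
  covariant_derivative (E := fun m => ahull (A m)) sAt sA
    (pi := @projT1 M (fun m => A m)) D /\
  forall U s a (O : set Ahull) W (t : forall z : Ahull, ahull (A (projT1 z))),
    vfield sA setT U -> smooth_section sA sAt setT s ->
    mopen sAt O -> O `<=` hull_complement -> O (hull_embedding a) ->
    vfield sAt O W ->
    smooth_section (pi := @projT1 M (fun m => ahull (A m))) sAt sAt O t ->
    W (hull_embedding a) = pushforward sAt hull_embedding a (U a) ->
    (forall a', O (hull_embedding a') -> t (hull_embedding a') = s a') ->
    D U s a = linearization sAt kappat W t (hull_embedding a).

End AffineConnection.

Arguments hull_complement {R M V} A.

(* Main.v *)
Require Import Defs.
From HB Require Import structures.
From mathcomp Require Import all_boot all_order all_algebra.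
From mathcomp Require Import all_classical all_reals all_analysis.
From mathcomp Require Import ring.

Set Implicit Arguments.
Unset Strict Implicit.
Unset Printing Implicit Defensive.

Import Order.TTheory GRing.Theory Num.Theory numFieldNormedType.Exports.
Local Open Scope classical_set_scope.
Local Open Scope ring_scope.

(** The formula is local: near a point [a] of the affine bundle, the value
[D U s a] may be computed from any vector field [W] and any section [t] on the
hull minus the vector part, as soon as [W] extends the image of [U a] and [t]
extends [s]. The retraction [rho] along the rays from the origin, [z = j(z)
rho(z)], gives convenient ones. For [t] take [s \o rho]. For [W] take [X]
plus the vertical lift of the connector part of [U], where [X] is the
homogeneous horizontal lift of the base part of [U] at [rho z].

With this choice the horizontal part of [W] is [X], and
[t = tbar + h z] where [tbar = sbar \o rho] takes its values in the vector
part, [h = (j(s) \o rho) / j] and [z] is the tautological section. Its vertical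
lift is the Euler field [E], so that
[[X, t^V] = [X, tbar^V] + X(h) E + h [X, E]].
Three facts then conclude.

- [[X, E]] vanishes on the affine bundle ([bracket_extension_Euler]): it is a
  tangent vector of the hull which kills the functions coming from the base,
  since [X] applied to them is constant along rays, and the linear fibre
  coordinates, since [X] applied to them is homogeneous of degree one.
- [X] and [tbar^V] restrict on the affine bundle to the images of the
  horizontal part of [U] and of [sbar^V], so [[X, tbar^V]] is the image of the
  bracket computed there ([bracket_related]); and the two connectors agree on
  images of tangent vectors ([connector_embedding]).
- The connector part of [W] at a point [a] is that of [U], and [t] restricts to
  [s], so the fibre derivatives agree ([vertical_part]).

Both the first and the second fact use that a derivation of germs is determined
by its values on coordinates: a tangent vector of a bundle that is killed by the
projection is a vertical lift ([vertical_tangent]). Since tangent vectors are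
derivations, this is the chain rule [v (G \o F) = \sum_i v(F_i) d_i G], which
requires dividing a smooth function by a coordinate without losing smoothness
([Hadamard], [tangent_chain]). The quotient [(f(x) - f(pi x)) / xi(x)] is shown
to be smooth by treating at once all the higher Taylor quotients along one
direction: each directional derivative of such a quotient is a linear
combination of Taylor quotients, by symmetry of mixed derivatives. *)

(** * Differentiability of all orders *)

(* The bare name also denotes the image of a measure. *)
Local Notation pushforward := Defs.pushforward.

Section NearEq.
Context {R : realType} {X Y : normedModType R}.

Lemma is_diff_ext (f g df dg : X -> Y) x : is_diff x f df ->
  f =1 g -> df =1 dg -> is_diff x g dg.
Proof. by move=> h /funext <- /funext <-. Qed.

Lemma is_diff_epsP (f : X -> Y) (a : X) (df : {linear X -> Y}) :
  continuous df ->
  (forall e : R, 0 < e -> \forall h \near (0:X), `|f (h + a) -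
    (f a + df h)| <= e * `|h|) ->
  is_diff a f df.
Proof.
move=> cdf H.
have E : f \o shift a = cst (f a) + df +o_ (0:X) id.
  apply/eqaddoP => e e0; exact: H.
have D : 'd f a = df :> (X -> Y) by apply: diff_unique.
by split => //; apply/diff_locallyP; rewrite D; split.
Qed.

Lemma diff_eps (f : X -> Y) (a : X) : differentiable f a ->
  forall e : R, 0 < e -> \forall h \near (0:X), `|f (h + a) -
    (f a + 'd f a h)| <= e * `|h|.
Proof.
by move=> /diff_locallyP[_ /eqaddoP H] e e0; exact: H.
Qed.

(** Differentiability is a property of germs: the first-order expansion transfers
from [f] to [g], with the same linear part. *)
Lemma near_eq_differentiable (f g : X -> Y) (a : X) : (\near a, f a = g a) ->
  differentiable f a -> differentiable g a.
Proof.
move=> fg df; have fga := nbhs_singleton fg.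
suff : is_diff a g ('d f a) by case.
apply: is_diff_epsP; first exact: diff_continuous.
move=> e e0; have := diff_eps df e0.
have : \forall h \near (0:X), f (h + a) = g (h + a).
  by move: fg; rewrite (near_shift 0) /=; apply: filterS => h /=; rewrite subr0.
by apply: filterS2 => h ->; rewrite fga.
Qed.
End NearEq.

Section UptoBasics.
Context {R : realType} {X : normedModType R}.
Implicit Types (O : set X) (f g : X -> R).

Lemma is_diff_derive f x : differentiable f x -> is_diff x f (fun v => 'D_v f x).
Proof.
move=> df; split => //; apply/funext => v /=; by rewrite deriveE.
Qed.

Lemma is_diff_deriveE f df x v : is_diff x f df -> 'D_v f x = df v.
Proof. by move=> [h <-]; rewrite deriveE. Qed.

Lemma upto_eq (Y : normedModType R) (k : nat) O (f g : X -> Y) : open O ->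
  (forall x, O x -> f x = g x) ->
  differentiable_upto k O f -> differentiable_upto k O g.
Proof.
move=> oO; elim: k f g => [//|k IH] f g fg /= [df Df].
have nfg x : O x -> \near x, f x = g x.
  move=> Ox; have := open_nbhs_nbhs (conj oO Ox).
  exact: filterS.
split=> [x Ox|v].
  exact: near_eq_differentiable (nfg x Ox) (df x Ox).
apply: IH (Df v) => x Ox; apply: near_eq_derive; exact: nfg.
Qed.

Lemma upto_sub (Y : normedModType R) (k : nat) O O' (f : X -> Y) : O' `<=` O ->
  differentiable_upto k O f -> differentiable_upto k O' f.
Proof.
move=> s; elim: k f => [//|k IH] f /= [df Df]; split=> [x /s/df //|v].
exact: IH.
Qed.

Lemma uptoW (Y : normedModType R) (k : nat) O (f : X -> Y) :
  differentiable_upto k.+1 O f -> differentiable_upto k O f.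
Proof.
elim: k f => [//|k IH] f [df Df]; split=> // v; exact: IH.
Qed.

Lemma upto_cst k O (c : R) : differentiable_upto k O (fun=> c : R).
Proof.
elim: k c => [//|k IH] c; split=> [x _|v]; first exact: differentiable_cst.
have -> : 'D_v (fun=> c) = fun=> 0 by apply/funext => x; apply: (derive_cst c).
exact: IH.
Qed.

Lemma uptoD k O f g : open O -> differentiable_upto k O f ->
  differentiable_upto k O g -> differentiable_upto k O (fun x => f x + g x).
Proof.
move=> oO; elim: k f g => [//|k IH] f g [df Df] [dg Dg]; split=> [x Ox|v].
  by apply: differentiableD; [apply: df|apply: dg].
apply: (upto_eq oO) (IH _ _ (Df v) (Dg v)) => x Ox.
by rewrite (@is_diff_deriveE _ _ _ _
  (is_diffD (is_diff_derive (df x Ox)) (is_diff_derive (dg x Ox)))).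
Qed.

Lemma uptoM k O f g : open O -> differentiable_upto k O f ->
  differentiable_upto k O g -> differentiable_upto k O (fun x => f x * g x).
Proof.
move=> oO; elim: k f g => [//|k IH] f g hf hg.
have [df Df] := hf; have [dg Dg] := hg; split=> [x Ox|v].
  by apply: differentiableM; [apply: df|apply: dg].
have H := uptoD oO (IH _ _ (uptoW hf) (Dg v)) (IH _ _ (uptoW hg) (Df v)).
apply: (upto_eq oO) H => x Ox.
by rewrite (@is_diff_deriveE _ _ _ _
  (is_diffM (is_diff_derive (df x Ox)) (is_diff_derive (dg x Ox)))).
Qed.

Lemma upto_sum k O (I : Type) (r : seq I) (F : I -> X -> R) : open O ->
  (forall i, differentiable_upto k O (F i)) ->
  differentiable_upto k O (fun x => \sum_(i <- r) F i x).
Proof.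
move=> oO hF; elim: r => [|i r IH].
  apply: (upto_eq oO) (upto_cst k O 0) => x _; by rewrite big_nil.
by apply: (upto_eq oO) (uptoD oO (hF i) IH) => x _; rewrite big_cons.
Qed.

End UptoBasics.

Section Cinfty.
Context {R : realType} {X : normedModType R}.
Implicit Types (O : set X) (f g : X -> R).

Lemma Cinfty_eq O f g : open O -> (forall x, O x -> f x = g x) ->
  Cinfty_on O f -> Cinfty_on O g.
Proof. by move=> oO fg hf k; apply: upto_eq fg (hf k). Qed.

Lemma Cinfty_sub (Y : normedModType R) O O' (f : X -> Y) : O' `<=` O ->
  Cinfty_on O f -> Cinfty_on O' f.
Proof. by move=> s hf k; apply: upto_sub s (hf k). Qed.

Lemma Cinfty_derive O f v : Cinfty_on O f -> Cinfty_on O ('D_v f).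
Proof. by move=> hf k; have [_] := hf k.+1; apply. Qed.

Lemma Cinfty_differentiable (Y : normedModType R) O (f : X -> Y) x : Cinfty_on O f ->
  O x ->
  differentiable f x.
Proof. by move=> hf Ox; have [+ _] := hf 1%N; apply. Qed.

Lemma Cinfty_cst O (c : R) : Cinfty_on O (fun=> c).
Proof. by move=> k; exact: upto_cst. Qed.

Lemma CinftyD O f g : open O -> Cinfty_on O f -> Cinfty_on O g ->
  Cinfty_on O (fun x => f x + g x).
Proof. by move=> oO hf hg k; apply: uptoD. Qed.

Lemma CinftyM O f g : open O -> Cinfty_on O f -> Cinfty_on O g ->
  Cinfty_on O (fun x => f x * g x).
Proof. by move=> oO hf hg k; apply: uptoM. Qed.

Lemma Cinfty_linear O (l : {linear X -> R}) : open O -> continuous l -> Cinfty_on O l.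
Proof.
move=> oO cl k; case: k => [//|k]; split=> [x _|v].
  exact: linear_differentiable.
apply: (upto_eq oO) (upto_cst k O (l v)) => x _.
by rewrite deriveE ?diff_lin //; exact: linear_differentiable.
Qed.

End Cinfty.

Section Comp.
Context {R : realType} {X : normedModType R} {n : nat}.
Implicit Types (O : set X) (g : X -> 'rV[R]_n).

Lemma is_diff_row g x : (forall j, differentiable (fun x => g x 0 j) x) ->
  is_diff x g (fun v => \row_j 'D_v (fun x => g x 0 j) x).
Proof.
move=> h.
have E : g = \sum_(j < n) (fun x => g x 0 j *: (delta_mx 0 j : 'rV[R]_n)).
  by apply/funext => y; rewrite fct_sumE {1}[g y]row_sum_delta.
have dg : differentiable g x.
  by rewrite E; apply: differentiable_sum => j; apply: differentiableZl.
split=> //; apply/funext => v; rewrite -deriveE // derive_mx; last exact: diff_derivable.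
by apply/matrixP => i j; rewrite !mxE ord1.
Qed.

Lemma derive_comp_row g (f : 'rV[R]_n -> R) x v :
  (forall j, differentiable (fun x => g x 0 j) x) -> differentiable f (g x) ->
  'D_v (f \o g) x = \sum_j 'D_v (fun x => g x 0 j) x * 'D_(delta_mx 0 j) f (g x).
Proof.
move=> hg hf; have dg := is_diff_row hg.
rewrite (is_diff_deriveE _ (is_diff_comp dg (differentiableP hf))) /=.
rewrite [X in 'd f _ X]row_sum_delta linear_sum; apply: eq_bigr => j _.
by rewrite linearZ mxE /= -deriveE.
Qed.

(** The derivatives of [f \o g] are sums of products of derivatives of [g] with
functions [f' \o g] of the same kind, so an induction on the order applies to
all smooth [f] at once. Smoothness of [g] is only asked of its coordinates, the
form in which it comes out of germs of functions on a manifold. *)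
Lemma Cinfty_comp O (O' : set 'rV[R]_n) g (f : 'rV[R]_n -> R) : open O ->
  (forall x, O x -> O' (g x)) ->
  (forall j, Cinfty_on O (fun x => g x 0 j : R)) -> Cinfty_on O' f -> Cinfty_on O
    (f \o g).
Proof.
move=> oO gO hg hf k.
elim: k f hf => [//|k IH] f hf; split=> [x Ox|v].
  apply: differentiable_comp; last exact: Cinfty_differentiable hf (gO _ Ox).
  have [//] : is_diff x g _ := is_diff_row (fun j => Cinfty_differentiable (hg j) Ox).
have H := @upto_sum _ _ k O _ (index_enum 'I_n)
  (fun j x => 'D_v (fun x => g x 0 j) x * ('D_(delta_mx 0 j) f \o g) x) oO.
apply: (upto_eq oO) (H _) => [x Ox|j].
  rewrite derive_comp_row //; last exact: Cinfty_differentiable hf (gO _ Ox).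
  by move=> j; exact: Cinfty_differentiable (hg j) Ox.
apply: (uptoM oO); first exact: Cinfty_derive.
by apply: IH; exact: Cinfty_derive.
Qed.

Lemma Cinfty_coord O g j : open O -> Cinfty_on O g -> Cinfty_on O (fun x => g x 0 j : R).
Proof.
move=> oO hg k; elim: k g hg => [//|k IH] g hg; split=> [x Ox|v].
  apply: (@differentiable_comp _ _ _ _ g (fun N : 'rV[R]_n => N 0 j : R)).
    exact: Cinfty_differentiable hg Ox.
  exact: differentiable_coord.
have hD : Cinfty_on O ('D_v g) by move=> m; have [_] := hg m.+1; apply.
apply: (upto_eq oO) (IH _ hD) => x Ox.
rewrite derive_mx ?mxE //.
exact/diff_derivable/(Cinfty_differentiable hg Ox).
Qed.

End Comp.

Lemma CinftyV (R : realType) (X : normedModType R) (O : set X) (f : X -> R) : open O ->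
  (forall x, O x -> f x != 0) -> Cinfty_on O f -> Cinfty_on O (fun x => (f x)^-1).
Proof.
move=> oO f0 hf; elim=> [//|k IH]; split=> [x Ox|v].
  exact: differentiableV (Cinfty_differentiable hf Ox) (f0 _ Ox).
have [_ /(_ v) hD] := hf k.+1.
have H := uptoM oO (uptoM oO (upto_cst k O (- 1)) hD) (uptoM oO IH IH).
apply: (upto_eq oO) H => x Ox.
rewrite (deriveV (f0 _ Ox)); last exact: diff_derivable (Cinfty_differentiable hf Ox).
by rewrite /GRing.scale /=; have := f0 _ Ox => fx; field.
Qed.

(** * Mean values along segments and symmetry of mixed derivatives *)

Section Schwarz.
Context {R : realType} {X : normedModType R}.
Implicit Types (O : set X) (f g : X -> R).

Lemma is_derive_line f (y w : X) (t : R) : differentiable f (y + t *: w) ->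
  is_derive t 1 (fun t : R => f (y + t *: w)) ('D_w f (y + t *: w)).
Proof.
move=> df.
have dl : is_diff t (fun t : R => y + t *: w) (fun s => s *: w).
  apply: (is_diff_ext (is_diffD (is_diff_cst y t) (is_diff_scalel t w))) => s //.
  by rewrite !fctE add0r.
have [d e] := is_diff_comp dl (differentiableP df).
split; first exact: diff_derivable.
by rewrite deriveE // e /= scale1r -deriveE.
Qed.

Lemma is_derive_line0 f (y w : X) : differentiable f y ->
  is_derive (0 : R) 1 (fun t : R => f (y + t *: w)) ('D_w f y).
Proof.
have y0 : y + (0 : R) *: w = y by rewrite scale0r addr0.
by move=> df; have := @is_derive_line f y w 0; rewrite y0; apply.
Qed.

Lemma MVT_vec f (y w : X) :
  (forall t : R, 0 <= t <= 1 -> differentiable f (y + t *: w)) ->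
  exists2 t : R, 0 <= t <= 1 & f (y + w) - f y = 'D_w f (y + t *: w).
Proof.
move=> df.
have dg (t : R) t01 := is_derive_line (df t t01).
have := @MVT_segment R (fun t => f (y + t *: w)) (fun t => 'D_w f (y + t *: w)) 0 1 ler01.
case.
- move=> t; rewrite in_itv /= => /andP[t0 t1]; apply: dg; by rewrite !ltW.
- apply: continuous_in_subspaceT => t; rewrite inE /= in_itv /= => t01.
  by apply: differentiable_continuous; apply/derivable1_diffP; have [] := dg t t01.
- by move=> t; rewrite in_itv /= scale0r addr0 scale1r subr0 mulr1 => t01 e; exists t.
Qed.

Lemma deriveZv f x v (k : R) : differentiable f x -> 'D_(k *: v) f x = k * 'D_v f x.
Proof. by move=> df; rewrite !deriveE // linearZ. Qed.

Lemma deriveBv f x u v : differentiable f x -> 'D_(u - v) f x = 'D_u f x - 'D_v f x.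
Proof. by move=> df; rewrite !deriveE // linearB. Qed.

(** The mean value theorem applied twice, first to the increment of [f] in the
direction [v], then to ['D_u f]. The left-hand side is symmetric in [u] and
[v], which is the source of the symmetry of mixed derivatives. *)
Lemma second_difference O f x u v : open O -> Cinfty_on O f ->
  (forall s t : R, 0 <= s <= 1 -> 0 <= t <= 1 -> O (x + s *: u + t *: v)) ->
  exists s t : R, [/\ 0 <= s <= 1, 0 <= t <= 1 &
    f (x + u + v) - f (x + u) - (f (x + v) - f x) =
    'D_v ('D_u f) (x + s *: u + t *: v)].
Proof.
move=> oO hf hO.
have dif y : O y -> differentiable f y by exact: Cinfty_differentiable.
have hO0 s : 0 <= s <= 1 -> O (x + s *: u).
  by move=> s01; have := hO s 0 s01; rewrite scale0r addr0 lexx ler01; apply.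
have hO1 s : 0 <= s <= 1 -> O (x + s *: u + v).
  by move=> s01; have := hO s 1 s01; rewrite scale1r lexx ler01; apply.
have dsh y : O (y + v) -> is_diff y (fun z => f (z + v)) (fun w => 'D_w f (y + v)).
  move=> Oy; apply: (is_diff_ext
    (is_diff_comp (is_diffD (is_diff_id y) (is_diff_cst v y))
      (differentiableP (dif _ Oy)))) => w //.
  by rewrite /= !fctE addr0 deriveE //; exact: dif.
have d1 t : 0 <= t <= 1 -> is_diff (x + t *: u) (fun z => f (z + v) - f z)
   (fun w => 'D_w f (x + t *: u + v) - 'D_w f (x + t *: u)).
  move=> t01; exact: is_diffB (dsh _ (hO1 _ t01)) (is_diff_derive (dif _ (hO0 _ t01))).
have [t|s s01] := @MVT_vec (fun z => f (z + v) - f z) x u.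
  by move/d1 => [].
rewrite (is_diff_deriveE _ (d1 s s01)) => E1.
have [t t01|t t01 E2] := @MVT_vec ('D_u f) (x + s *: u) v.
  by apply: (@Cinfty_differentiable _ _ _ O); [exact: Cinfty_derive|exact: hO].
by exists s, t; split=> //; rewrite -E2 -E1 opprB !addrA.
Qed.

(** The second difference over the parallelogram of sides [h u] and [h v] is
[h ^+ 2] times either mixed derivative at some point of it; both tend to their
value at [x] as [h] shrinks. *)
Lemma Schwarz O f x u v : open O -> Cinfty_on O f -> O x ->
  'D_v ('D_u f) x = 'D_u ('D_v f) x.
Proof.
move=> oO hf Ox; apply/eqP; rewrite -subr_eq0 -normr_le0; apply/ler_addgt0Pl => e e0;
  rewrite addr0.
have e2 : 0 < e / 2 by rewrite divr_gt0.
have dif (g : X -> R) : Cinfty_on O g -> forall y, O y -> differentiable g y.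
  by move=> hg y; exact: Cinfty_differentiable.
have cA : {for x, continuous ('D_v ('D_u f))}.
  by apply: differentiable_continuous; apply: (dif _ _ _ Ox); do 2 apply: Cinfty_derive.
have cB : {for x, continuous ('D_u ('D_v f))}.
  by apply: differentiable_continuous; apply: (dif _ _ _ Ox); do 2 apply: Cinfty_derive.
have : \forall y \near x, [/\ O y, `|'D_v ('D_u f) x - 'D_v ('D_u f) y| < e / 2 &
   `|'D_u ('D_v f) x - 'D_u ('D_v f) y| < e / 2].
  have HO : \forall y \near x, O y by exact: open_nbhs_nbhs.
  have /cvgrPdist_lt/(_ _ e2) HA := cA.
  have /cvgrPdist_lt/(_ _ e2) HB := cB.
  apply: (filterS _ (filterI HO (filterI HA HB))) => y [Oy [Ay By]].
  by split; [exact: Oy|exact: Ay|exact: By].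
move=> /nbhs_ballP[d /= d0 hd].
(* [h] is so small that the parallelogram stays within the ball where both
   mixed derivatives are close to their value at [x] *)
have uv0 : 0 < `|u| + `|v| + 1 by rewrite ltr_wpDl // addr_ge0.
have [h h0 hd'] : exists2 h : R, 0 < h & h * (`|u| + `|v| + 1) < d.
  exists (d / (2 * (`|u| + `|v| + 1))); first by rewrite divr_gt0 // mulr_gt0.
  by rewrite invfM mulrA mulfVK ?gt_eqF // ltr_pdivrMr // ltr_pMr // ltr1n.
have inb (s t : R) : 0 <= s <= 1 -> 0 <= t <= 1 -> ball x d
  (x + s *: (h *: u) + t *: (h *: v)).
  move=> /andP[s0 s1] /andP[t0 t1]; rewrite -ball_normE /ball_ /=.
  rewrite opprD opprD !addrA subrr add0r -opprD normrN.
  apply: (le_lt_trans (ler_normD _ _)); rewrite !normrZ !ger0_norm // ?(ltW h0) //.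
  apply: le_lt_trans hd'.
  rewrite !mulrDr mulr1 -[leLHS]addr0; apply: lerD; last exact: ltW h0.
  by apply: lerD; rewrite ler_piMl // mulr_ge0 // (ltW h0).
have inO s t : 0 <= s <= 1 -> 0 <= t <= 1 -> O (x + s *: (h *: u) + t *: (h *: v)).
  by move=> s01 t01; have [] := hd _ (inb s t s01 t01).
have inO' s t : 0 <= s <= 1 -> 0 <= t <= 1 -> O (x + s *: (h *: v) + t *: (h *: u)).
  by move=> s01 t01; rewrite addrAC; exact: inO.
have Dh w w' y : O y -> 'D_(h *: w') ('D_(h *: w) f) y = h * h * 'D_w' ('D_w f) y.
  move=> Oy; have df := dif _ hf; have dDf z : O z -> differentiable
    ('D_w f) z by apply: dif; exact: Cinfty_derive.
  rewrite deriveZv; last by apply: (dif _ _ _ Oy); exact: Cinfty_derive.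
  rewrite (@near_eq_derive _ _ _ _ (h \*: 'D_w f)); last first.
    have : \near y, O y by exact: open_nbhs_nbhs.
    by apply: filterS => z Oz; rewrite /= deriveZv //; exact: df.
  rewrite (deriveZ h (diff_derivable (v:=w') (dDf y Oy))).
  exact: mulrA.
have [s [t [s01 t01 E1]]] := second_difference oO hf inO.
have [s' [t' [s01' t01' E2]]] := second_difference oO hf inO'.
have E : 'D_v ('D_u f) (x + s *: (h *: u) + t *: (h *: v)) =
   'D_u ('D_v f) (x + t' *: (h *: u) + s' *: (h *: v)).
  apply: (@mulfI _ (h * h)); first by rewrite mulf_neq0 // gt_eqF.
  apply: (etrans (esym (Dh u v _ (inO _ _ s01 t01)))).
  apply: (etrans _ (Dh v u _ (inO _ _ t01' s01'))).
  by rewrite -E1 [x + t' *: _ + _]addrAC -E2 [x + _ + h *: u]addrAC opprB opprB !addrA;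
    ring.
have [_ H1 _] := hd _ (inb s t s01 t01).
have [_ _ H2] := hd _ (inb t' s' t01' s01').
rewrite -E in H2.
rewrite (splitr e).
apply: (le_trans (ler_distD ('D_v ('D_u f) (x + s *: (h *: u) + t *: (h *: v))) _ _)).
by apply: lerD; [exact: ltW H1|rewrite distrC; exact: ltW H2].
Qed.
End Schwarz.

(** * Division of a smooth function by a coordinate *)

Section Hadamard.
Context {R : realType} {X : normedModType R}.
Variables (l : {linear X -> R}) (e p : X) (B : set X).
Hypotheses (cl : continuous l) (le1 : l e = 1) (oB : open B).

(** An affine coordinate and the projection along [e] onto its zero set, the slice
through [p]. *)
Definition slice_coord (x : X) : R := l (x - p).
Definition slice_proj (x : X) : X := x - slice_coord x *: e.

(* [B] contains the segment from the projection of each of its points to that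
   point, along which Taylor expansions are taken *)
Hypothesis segB : forall x, B x -> forall t : R, 0 <= t <= 1 ->
  B (slice_proj x + t *: (slice_coord x *: e)).

Definition iter_derive (k : nat) (f : X -> R) : X -> R := iter k (fun g => 'D_e g) f.

(** The remainder of the Taylor expansion of order [k] along [e], based on the
slice. *)
Definition taylor_rest (k : nat) (f : X -> R) (x : X) : R :=
  f x - \sum_(j < k) slice_coord x ^+ j / j`!%:R * iter_derive j f (slice_proj x).

(** The remainder divided by the [k]-th power of the coordinate, with its limit
value on the slice. *)
Definition taylor_quot (k : nat) (f : X -> R) (x : X) : R :=
  if slice_coord x == 0 then iter_derive k f x / k`!%:R else taylor_rest k f x / slice_coord x ^+ k.

Lemma is_diff_slice_coord x : is_diff x slice_coord l.
Proof.
apply: (is_diff_ext (f := fun x => l x - l p) (df := fun v => l v - 0)).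
- have dl : is_diff x l l.
    split; [exact: linear_differentiable|]; exact: diff_lin.
  exact: (is_diffB dl (is_diff_cst (l p) x)).
- by move=> y; rewrite /slice_coord linearB.
- by move=> v; rewrite subr0.
Qed.

Lemma is_diff_slice_proj x : is_diff x slice_proj (fun v => v - l v *: e).
Proof.
apply: is_diffB (is_diff_id x) _.
exact: (is_diff_ext (is_diff_comp (is_diff_slice_coord x)
  (is_diff_scalel (slice_coord x) e))).
Qed.

Lemma slice_coordD x (c : R) : slice_coord (x + c *: e) = slice_coord x + c.
Proof. rewrite /slice_coord addrAC linearD linearZ le1; congr (_ + _); exact: mulr1. Qed.

Lemma slice_coord_proj x : slice_coord (slice_proj x) = 0.
Proof. by rewrite /slice_proj -scaleNr slice_coordD subrr. Qed.

Lemma slice_proj_id x : slice_coord x = 0 -> slice_proj x = x.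
Proof. by rewrite /slice_proj => ->; rewrite scale0r subr0. Qed.

Lemma slice_proj_stable x : B x -> B (slice_proj x).
Proof. by move=> /segB/(_ 0); rewrite scale0r addr0 lexx ler01; apply. Qed.

Lemma Cinfty_iter_derive k f : Cinfty_on B f -> Cinfty_on B (iter_derive k f).
Proof. by move=> hf; elim: k => [//|k IH]; exact: Cinfty_derive. Qed.

(** Iterated symmetry of mixed derivatives. *)
Lemma derive_iter_derive k f v x : Cinfty_on B f -> B x ->
  'D_v (iter_derive k f) x = iter_derive k ('D_v f) x.
Proof.
move=> hf; elim: k x => [//|k IH] x Bx.
rewrite [in LHS]/iter_derive iterS -/(iter_derive k f).
rewrite (Schwarz _ _ oB (Cinfty_iter_derive k hf) Bx).
rewrite [in RHS]/iter_derive iterS -/(iter_derive k _).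
apply: near_eq_derive.
have : \near x, B x by exact: open_nbhs_nbhs.
by apply: filterS => y By; apply: IH.
Qed.

Lemma is_diff_iter_derive_proj k f x : Cinfty_on B f -> B x ->
  is_diff x (fun x => iter_derive k f (slice_proj x))
    (fun v => iter_derive k ('D_v f) (slice_proj x) - l v * iter_derive k.+1 f
      (slice_proj x)).
Proof.
move=> hf Bx; have Bp := slice_proj_stable Bx.
have df := Cinfty_differentiable (Cinfty_iter_derive k hf) Bp.
apply: (is_diff_ext (is_diff_comp (is_diff_slice_proj x) (is_diff_derive df))) => v //=.
rewrite deriveBv // deriveZv // derive_iter_derive //.
Qed.

Lemma taylor_restS k f x : taylor_rest k.+1 f x =
  taylor_rest k f x - slice_coord x ^+ k / k`!%:R * iter_derive k f (slice_proj x).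
Proof. by rewrite /taylor_rest big_ord_recr /= opprD addrA. Qed.

Lemma fact_natr_neq0 k : (k`!%:R : R) != 0.
Proof. by rewrite pnatr_eq0 -lt0n fact_gt0. Qed.

(** Differentiating the remainder of [f] gives that of ['D_v f], up to the motion of
the base point and of the coordinate; those contributions telescope, and only
the one of top order survives. *)
Lemma is_diff_taylor_rest k f x : Cinfty_on B f -> B x ->
  is_diff x (taylor_rest k.+1 f) (fun v => taylor_rest k.+1 ('D_v f) x +
    l v * (slice_coord x ^+ k / k`!%:R * iter_derive k.+1 f (slice_proj x))).
Proof.
move=> hf Bx; elim: k => [|k IH].
  have d := is_diffB (is_diff_derive (Cinfty_differentiable hf Bx))
    (is_diff_iter_derive_proj 0 hf Bx).
  apply: (is_diff_ext d) => [y|v].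
    by rewrite !fctE /= /taylor_rest big_ord1 expr0 fact0 divr1 mul1r.
  by rewrite !fctE /= /taylor_rest big_ord1 expr0 fact0 divr1 !mul1r opprB addrAC addrA.
have d := is_diffB IH (is_diffM
  (is_diffZ (k.+1`!%:R^-1) (is_diffX k (is_diff_slice_coord x)))
   (is_diff_iter_derive_proj k.+1 hf Bx)).
apply: (is_diff_ext d) => [y|v].
  rewrite taylor_restS !fctE /=; congr (_ - _ * _).
  by rewrite [LHS]mulrC.
rewrite [in RHS]taylor_restS !fctE /GRing.scale /=.
have kn : (k.+1%:R : R) != 0 by rewrite pnatr_eq0.
have := fact_natr_neq0 k => fn.
rewrite factS natrM !exprS.
by field; rewrite fn nat1r kn.
Qed.

Lemma taylor_quotS k f x : slice_coord x != 0 ->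
  taylor_quot k.+1 f x = (taylor_quot k f x - iter_derive k f
    (slice_proj x) / k`!%:R) / slice_coord x.
Proof.
move=> x0; rewrite /taylor_quot (negbTE x0) taylor_restS exprS.
have := fact_natr_neq0 k => fn; move: (slice_coord x) x0 => h h0.
by field; rewrite fn h0 expf_neq0.
Qed.

Lemma taylor_quot0 f x : taylor_quot 0 f x = f x.
Proof.
rewrite /taylor_quot /taylor_rest big_ord0 subr0 expr0 fact0 !divr1 /=.
by case: ifP.
Qed.

(** The recursion relation; applied twice it expands a quotient to second order
around the slice. *)
Lemma taylor_quot_expand k f x :
  taylor_quot k f x = iter_derive k f
    (slice_proj x) / k`!%:R + slice_coord x * taylor_quot k.+1 f x.
Proof.
case: (eqVneq (slice_coord x) 0) => [x0|x0];
  last by rewrite taylor_quotS // mulrCA mulfV // mulr1 subrKC.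
by rewrite x0 mul0r addr0 slice_proj_id // /taylor_quot x0 eqxx.
Qed.

(** Off the slice the quotient is an explicit combination of smooth functions. The
point is that its derivative is again a combination of Taylor quotients. *)
Lemma is_diff_taylor_quot_off k f x : Cinfty_on B f -> B x -> slice_coord x != 0 ->
  is_diff x (taylor_quot k f) (fun v => taylor_quot k ('D_v f) x -
    k%:R * l v * taylor_quot k.+1 f x).
Proof.
move=> hf Bx x0.
case: k => [|k].
  apply: (is_diff_ext (is_diff_derive (Cinfty_differentiable hf Bx))) => [y|v].
    by rewrite taylor_quot0.
  by rewrite taylor_quot0 !mul0r subr0.
have dV : is_diff x (fun y => ((slice_coord ^+ k.+1) y)^-1)
    (fun v => - (k.+1%:R * l v) * (slice_coord x ^+ k.+2)^-1).
  have [dh eh] := is_diff_slice_coord x.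
  have d1 : differentiable (slice_coord ^+ k.+1) x by exact: differentiableX.
  have e1 : (slice_coord ^+ k.+1) x != 0 by rewrite exprfctE expf_neq0.
  split; first exact: (differentiableV d1 e1).
  rewrite (diffV d1 e1) diffX // eh; apply/funext => v; rewrite !fctE /GRing.scale /=.
  rewrite ?exprfctE !exprS expr0 /GRing.scale /=.
  by move: (slice_coord x) x0 => h h0; field; rewrite h0 expf_neq0.
have d := is_diffM (is_diff_taylor_rest k hf Bx) dV.
have [dd ed] := d.
have E : \near x, (taylor_rest k.+1 f * (fun y => ((slice_coord ^+ k.+1) y)^-1)) x =
  taylor_quot k.+1 f x.
  have cx : {for x, continuous slice_coord}.
    by apply: differentiable_continuous; have [] := is_diff_slice_coord x.
  have : \near x, slice_coord x != 0 by apply: cvgr_neq0 cx x0.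
  by apply: filterS => y y0; rewrite /taylor_quot (negbTE y0) fctE exprfctE.
split; first exact: near_eq_differentiable E dd.
apply/funext => v; rewrite -deriveE; last exact: near_eq_differentiable E dd.
rewrite -(near_eq_derive v E) (is_diff_deriveE v d) !fctE /GRing.scale /=.
rewrite [in RHS]/taylor_quot (negbTE x0) [taylor_rest k.+2 _ _]taylor_restS.
have kn : (k.+1%:R : R) != 0 by rewrite pnatr_eq0.
have := fact_natr_neq0 k => fn.
rewrite factS natrM !exprS.
have -> : 'D_e (iter_derive k f) (slice_proj x) = iter_derive k.+1 f (slice_proj x) by [].
by move: (slice_coord x) x0 => h h0; field; rewrite fn nat1r kn h0 expf_neq0.
Qed.

(** The derivative along [e] of the remainder of order [k.+1] of [f] is the
remainder of order [k] of ['D_e f], so the bound propagates by the mean value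
theorem. *)
Lemma taylor_rest_bound k f y (c C : R) : Cinfty_on B f -> slice_coord y = 0 ->
  (forall t : R, 0 <= t <= 1 -> B (y + (t * c) *: e) /\
     `|iter_derive k f (y + (t * c) *: e)| <= C) ->
  forall t : R, 0 <= t <= 1 -> `|taylor_rest k f (y + (t * c) *: e)| <= C * `|c| ^+ k.
Proof.
move=> hf y0; elim: k f hf => [|k IH] f hf hC t /andP[t0 t1].
  rewrite expr0 mulr1 /taylor_rest big_ord0 subr0.
  by have [|_] := hC t; [rewrite t0 t1|].
have seg (s : R) : 0 <= s <= 1 -> 0 <= s * t <= 1.
  by move=> /andP[s0 s1]; rewrite mulr_ge0 //= mulr_ile1.
have Bs (s : R) : 0 <= s <= 1 -> B (y + s *: ((t * c) *: e)).
  by move=> /seg st; rewrite scalerA mulrA; have [] := hC _ st.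
have [s s01|s s01] := @MVT_vec _ _ (taylor_rest k.+1 f) y ((t * c) *: e).
  by have [] := is_diff_taylor_rest k hf (Bs _ s01).
have -> : taylor_rest k.+1 f y = 0.
  rewrite /taylor_rest big_ord_recl /= y0 expr0 fact0 divr1 mul1r slice_proj_id //.
  rewrite big1 ?addr0 ?subrr // => i _.
  by rewrite expr0n /= mul0r mul0r.
rewrite subr0 => ->.
have dS := is_diff_taylor_rest k hf (Bs _ s01).
rewrite deriveZv; last by case: dS.
rewrite (is_diff_deriveE _ dS) taylor_restS le1 mul1r.
rewrite [iter_derive k.+1 f]/iter_derive iterSr -/(iter_derive k _) subrK normrM exprS mulrCA.
apply: ler_pM => //.
  by rewrite normrM ger0_norm // ler_piMl.
have st := seg _ s01.
rewrite scalerA mulrA; apply: (IH _ (Cinfty_derive e hf)) => // r r01.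
have [Br hr] := hC _ r01; split=> //.
by rewrite [iter_derive k.+1 f]/iter_derive iterSr in hr.
Qed.

Lemma taylor_quot_bounded k f x0 : Cinfty_on B f -> B x0 -> slice_coord x0 = 0 ->
  exists C : R, \near x0, `|taylor_quot k f x0| <= C.
Proof.
move=> hf Bx0 h0.
have cD : {for x0, continuous (iter_derive k f)}.
  apply: differentiable_continuous; exact: Cinfty_differentiable
    (Cinfty_iter_derive k hf) Bx0.
pose C := `|iter_derive k f x0| + 1.
have : \near x0, B x0 /\ `|iter_derive k f x0| <= C.
  have HB : \near x0, B x0 by exact: open_nbhs_nbhs.
  have /cvgrPdist_lt/(_ _ ltr01) HD := cD.
  apply: (filterS _ (filterI HB HD)) => y [By yD]; split; first exact: By.
  rewrite -lerBlDl; apply: le_trans (lerB_dist _ _) _; rewrite distrC; exact: ltW yD.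
move=> /nbhs_ballP[d /= d0 hd].
have ch : {for x0, continuous slice_coord}.
  by apply: differentiable_continuous; have [] := is_diff_slice_coord x0.
have cp : {for x0, continuous slice_proj}.
  by apply: differentiable_continuous; have [] := is_diff_slice_proj x0.
have d2 : 0 < d / 2 by rewrite divr_gt0.
have e1 : 0 < `|e| + 1 by rewrite ltr_wpDl.
have d3 : 0 < d / 2 / (`|e| + 1) by rewrite divr_gt0.
have /cvgrPdist_lt/(_ _ d3) H1 := ch.
have /cvgrPdist_lt/(_ _ d2) H2 := cp.
exists C; apply: (filterS _ (filterI H1 H2)) => x [].
rewrite /= h0 sub0r normrN slice_proj_id // => hx px.
have inb (t : R) : 0 <= t <= 1 -> ball x0 d (slice_proj x + (t * slice_coord x) *: e).
  move=> /andP[t0 t1]; rewrite -ball_normE /ball_ /= opprD addrA.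
  apply: le_lt_trans (ler_normB _ _) _; rewrite [ltRHS]splitr; apply: ltr_leD => //.
  rewrite normrZ normrM ger0_norm //.
  apply: (@le_trans _ _ (`|slice_coord x| * `|e|)).
    by apply: ler_wpM2r => //; rewrite ler_piMl.
  apply: (@le_trans _ _ (d / 2 / (`|e| + 1) * (`|e| + 1))).
    by apply: ler_pM => //; [exact: ltW|rewrite lerDl].
  by rewrite mulfVK ?gt_eqF.
have bd := taylor_rest_bound hf (slice_coord_proj x) (fun t t01 => hd _ (inb t t01)).
have xE : slice_proj x + (1 * slice_coord x) *: e = x by rewrite mul1r subrK.
rewrite /taylor_quot; case: ifP => [x0'|/negbT x0'].
  have : `|iter_derive k f x| <= C.
    by have := hd _ (inb 1 _); rewrite xE => -[]//; rewrite ler01 lexx.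
  move=> hC; rewrite normrM; apply: le_trans hC; rewrite ler_piMr // normfV.
  by rewrite normr_nat invf_le1 ?ltr0n ?fact_gt0 // ler1n fact_gt0.
rewrite normrM normfV normrX ler_pdivrMr ?exprn_gt0 ?normr_gt0 //.
by have := bd 1; rewrite xE ler01 lexx; apply.
Qed.

Lemma is_diff_sqr_bounded (r : X -> R) x0 C : slice_coord x0 = 0 ->
  (\near x0, `|r x0| <= C) -> is_diff x0 (fun x => slice_coord x ^+ 2 * r x) (fun=> 0).
Proof.
move=> h0 hC.
have [k /= k0 hk] := linear_lipschitz cl.
have := @is_diff_epsP _ _ _ (fun x => slice_coord x ^+ 2 * r x) x0 \0.
apply => [|eps eps0]; first exact: cst_continuous.
rewrite h0 expr0n mul0r /=.
have C0 : 0 <= C by apply: le_trans (nbhs_singleton hC).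
have H1 : \forall h \near (0 : X), `|r (h + x0)| <= C.
  by move: hC; rewrite (near_shift 0) /=; apply: filterS => h /=; rewrite subr0.
have C1 : 0 < C + 1 by rewrite ltr_wpDl.
have [D D0 DE] : exists2 D : R, 0 < D & D * (k * k * (C + 1)) = eps.
  exists (eps / (k * k * (C + 1))); first by rewrite divr_gt0 // !mulr_gt0.
  by rewrite divfK // gt_eqF // !mulr_gt0.
have H2 : \forall h \near (0 : X), `|h| < D by exact: nbhs0_lt.
apply: (filterS _ (filterI H1 H2)) => h [hr hh].
have -> : slice_coord (h + x0) =
  l h by rewrite /slice_coord -addrA linearD -/(slice_coord x0) h0 addr0.
rewrite addr0 subr0 normrM normrX expr2 -DE.
apply: (@le_trans _ _ (k * `|h| * (k * `|h|) * (C + 1))).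
  apply: ler_pM => //; last by rewrite (le_trans hr) // lerDl.
  by apply: ler_pM => //; exact: hk.
rewrite [leLHS](_ : _ = `|h| * (k * k * (C + 1)) * `|h|); last by ring.
by apply: ler_wpM2r => //; apply: ler_wpM2r; [rewrite ltW // !mulr_gt0|exact: ltW].
Qed.

(** On the slice, the second-order expansion writes the quotient as a
differentiable function plus the square of the coordinate times a Taylor
quotient of higher order, which is bounded; the formula for the derivative is
then the same as off the slice. *)
Lemma is_diff_taylor_quot k f x : Cinfty_on B f -> B x ->
  is_diff x (taylor_quot k f) (fun v => taylor_quot k ('D_v f) x -
    k%:R * l v * taylor_quot k.+1 f x).
Proof.
move=> hf Bx; case: (eqVneq (slice_coord x) 0) => [h0|];
  last exact: is_diff_taylor_quot_off.
have [C hC] := taylor_quot_bounded k.+2 hf Bx h0.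
have d := is_diffD (is_diffD (is_diffZ (k`!%:R^-1) (is_diff_iter_derive_proj k hf Bx))
   (is_diffM (is_diff_slice_coord x)
     (is_diffZ (k.+1`!%:R^-1) (is_diff_iter_derive_proj k.+1 hf Bx))))
   (is_diff_sqr_bounded h0 hC).
apply: (is_diff_ext d) => [y|v].
  rewrite [RHS]taylor_quot_expand [taylor_quot k.+1 f y]taylor_quot_expand.
  by rewrite !fctE /GRing.scale /=; move: (slice_coord y) => h; ring.
rewrite !fctE /GRing.scale /= /taylor_quot h0 eqxx slice_proj_id //.
have kn : (k.+1%:R : R) != 0 by rewrite pnatr_eq0.
have := fact_natr_neq0 k => fn.
have -> : 'D_e (iter_derive k f) x = iter_derive k.+1 f x by [].
rewrite factS natrM; field; by rewrite fn nat1r kn.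
Qed.

(** The family of all Taylor quotients of all smooth functions is stable under
directional derivatives, up to linear combinations. *)
Lemma Cinfty_taylor_quot k f : Cinfty_on B f -> Cinfty_on B (taylor_quot k f).
Proof.
move=> hf m; elim: m k f hf => [//|m IH] k f hf; split=> [x Bx|v].
  by have [] := is_diff_taylor_quot k hf Bx.
apply: (upto_eq oB) (uptoD oB (IH k _ (Cinfty_derive v hf))
  (uptoM oB (upto_cst m B (- (k%:R * l v))) (IH k.+1 _ hf))) => x Bx.
by rewrite (is_diff_deriveE _ (is_diff_taylor_quot k hf Bx)) mulNr.
Qed.

Lemma Hadamard f : Cinfty_on B f -> exists g : X -> R,
  [/\ Cinfty_on B g, forall x, f x = f (slice_proj x) + slice_coord x * g x &
      forall x, slice_coord x = 0 -> g x = 'D_e f x].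
Proof.
move=> hf; exists (taylor_quot 1 f); split; first exact: Cinfty_taylor_quot.
  by move=> x; have := taylor_quot_expand 0 f x; rewrite taylor_quot0 fact0 divr1.
by move=> x h0; rewrite /taylor_quot h0 eqxx /= divr1.
Qed.

End Hadamard.

(** * Germs on a manifold *)

Section RowCoordinate.
Context {R : realType} {n : nat} (i : 'I_n).

Definition rcoord (x : 'rV[R]_n) : R := x 0 i.

Lemma rcoord_is_linear : linear rcoord.
Proof. by move=> k x y; rewrite /rcoord !mxE. Qed.

HB.instance Definition _ := GRing.isLinear.Build R 'rV[R]_n R _ rcoord rcoord_is_linear.

Lemma rcoord_continuous : continuous rcoord.
Proof. exact: coord_continuous. Qed.

Lemma Cinfty_rcoord (O : set 'rV[R]_n) : open O -> Cinfty_on O rcoord.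
Proof. by move=> oO; exact: (Cinfty_linear oO rcoord_continuous). Qed.

End RowCoordinate.

Section SmoothGerms.
Context {R : realType} {M : Type} (sM : atlas R M).

(** The neighbourhood filter of [p]. It is read in a chart, which makes it usable
together with [smooth_at]; there is no topology on [M] to begin with. *)
Definition nearby (p : M) (P : set M) :=
  exists c (O : set 'rV[R]_(mdim sM)), [/\ charts sM c /\ cdom c p, open O,
    O (cmap c p), O `<=` cmap c @` cdom c & forall y, O y -> P (cinv c y)].

Hypothesis hM : manifold sM.

Lemma open_preimage (X Y : topologicalType) (f : X -> Y) (D : set X) (O : set Y) :
  open D -> open O -> (forall x, D x -> {for x, continuous f}) ->
  open (D `&` f @^-1` O).
Proof.
move=> oD oO cf; rewrite openE => x [Dx Ox]; apply: filterI.
  exact: open_nbhs_nbhs.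
by apply: (cf x Dx); exact: open_nbhs_nbhs.
Qed.

(** Shrinking the domain of a transition map moves any condition stated in one
chart to another one. *)
Lemma chart_change c1 c p (O1 : set 'rV[R]_(mdim sM)) : charts sM c1 -> charts sM c ->
  cdom c1 p -> cdom c p -> open O1 -> O1 (cmap c1 p) ->
  exists O, [/\ open O, O (cmap c p), O `<=` cmap c @` (cdom c `&` cdom c1),
    forall y, O y -> O1 (cmap c1 (cinv c y)) & Cinfty_on O (cmap c1 \o cinv c)].
Proof.
move=> h1 h p1 p0 oO1 O1p.
pose D := cmap c @` (cdom c `&` cdom c1).
have oD : open D by exact: (chart_overlap_open hM).
have hD : Cinfty_on D (cmap c1 \o cinv c) by exact: (chart_transition hM).
exists (D `&` (cmap c1 \o cinv c) @^-1` O1); split.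
- apply: open_preimage => // x Dx; apply: differentiable_continuous.
  exact: Cinfty_differentiable hD Dx.
- by split; [exists p|rewrite /= (chart_cancel hM)].
- by move=> y [].
- by move=> y [].
- by apply: Cinfty_sub hD => y [].
Qed.

Lemma nearby_in_chart c p P : nearby p P -> charts sM c -> cdom c p ->
  exists O, [/\ open O, O (cmap c p), O `<=` cmap c @` cdom c &
   forall y, O y -> P (cinv c y)].
Proof.
move=> [c1 [ O1 [[h1 p1] oO1 O1p sO1 PO1]]] h p0.
have [ O [oO Op sO O1O _]] := chart_change h1 h p1 p0 oO1 O1p.
exists O; split=> // y Oy; first by have [q [+ _] <-] := sO _ Oy; exists q.
have := PO1 _ (O1O _ Oy); have [q [cq c1q] <-] := sO _ Oy.
by rewrite (chart_cancel hM h cq) (chart_cancel hM h1 c1q).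
Qed.

Lemma smooth_at_in_chart c p f : smooth_at sM p f -> charts sM c -> cdom c p ->
  exists O, [/\ open O, O (cmap c p), O `<=` cmap c @` cdom c &
   Cinfty_on O (f \o cinv c)].
Proof.
move=> [c1 [ O1 [[h1 p1] oO1 O1p sO1 fO1]]] h p0.
have [ O [oO Op sO O1O tO]] := chart_change h1 h p1 p0 oO1 O1p.
exists O; split=> // [y Oy|]; first by have [q [+ _] <-] := sO _ Oy; exists q.
have := @Cinfty_comp _ _ _ O O1 (cmap c1 \o cinv c) (f \o cinv c1) oO O1O _ fO1.
move/(_ (fun j => Cinfty_coord j oO tO)); apply: Cinfty_eq => // y Oy /=.
have [q [cq c1q] <-] := sO _ Oy.
by rewrite (chart_cancel hM h cq) (chart_cancel hM h1 c1q).
Qed.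

Lemma nearbyS p (P Q : set M) : P `<=` Q -> nearby p P -> nearby p Q.
Proof.
move=> PQ [c [ O [? ? ? ? h]]]; exists c, O; split=> // y /h; exact: PQ.
Qed.

Lemma nearby_self p P : nearby p P -> P p.
Proof.
by move=> [c [ O [[h1 h2] _ Op _ h]]]; rewrite -(chart_cancel hM h1 h2); exact: h.
Qed.

Lemma nearbyI p P Q : nearby p P -> nearby p Q -> nearby p (P `&` Q).
Proof.
move=> hP; have [c [ O [[h1 h2] oO Op sO h]]] := hP.
move=> /nearby_in_chart/(_ h1 h2)[ O' [oO' Op' _ h']].
exists c, (O `&` O'); split=> //; first exact: openI.
  by move=> y [/sO].
by move=> y [/h Py /h' Qy].
Qed.

Lemma chart_image_open c : charts sM c -> open (cmap c @` cdom c).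
Proof.
by move=> h; have := chart_overlap_open hM h h; rewrite setIid.
Qed.

Lemma mopenT : mopen sM setT.
Proof. by move=> c hc; rewrite setTI; exact: chart_image_open. Qed.

Lemma nearbyT p P : (forall q, P q) -> nearby p P.
Proof.
move=> hP; have [c h1 h2] := charts_cover hM p.
exists c, (cmap c @` cdom c); split=> //; exact: chart_image_open.
Qed.

Lemma nearby_chart c p : charts sM c -> cdom c p -> nearby p (cdom c).
Proof.
move=> h1 h2; exists c, (cmap c @` cdom c); split=> //; first exact: chart_image_open.
by move=> y [m cm <-]; rewrite (chart_cancel hM).
Qed.

Lemma nearby_mopen p W : mopen sM W -> W p -> nearby p W.
Proof.
move=> oW Wp; have [c h1 h2] := charts_cover hM p.
exists c, (cmap c @` (W `&` cdom c)); split=> //; first exact: oW.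
- by exists p.
- by move=> y [q [_ cq] <-]; exists q.
- by move=> y [q [Wq cq] <-]; rewrite (chart_cancel hM).
Qed.

Lemma smooth_at_nearby p f : smooth_at sM p f -> nearby p (fun q => smooth_at sM q f).
Proof.
move=> [c [ O [[h1 h2] oO Op sO h]]]; exists c, O; split=> // y Oy; exists c, O.
have [q cq E] := sO _ Oy; rewrite -E (chart_cancel hM h1 cq) E; split=> //.
Qed.

Lemma smooth_at_eq p f g : nearby p (fun q => f q = g q) -> smooth_at sM p f ->
  smooth_at sM p g.
Proof.
move=> E [c [ O [[h1 h2] oO Op sO h]]].
have [ O' [oO' Op' _ h']] := nearby_in_chart E h1 h2.
exists c, (O `&` O'); split=> //; first exact: openI.
  by move=> y [/sO].
apply: (@Cinfty_eq _ _ _ (f \o cinv c)); first exact: openI.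
  by move=> y [_ /h'].
by apply: Cinfty_sub h => y [].
Qed.

Lemma smooth_at_chart c p j : charts sM c -> cdom c p ->
  smooth_at sM p (fun q => cmap c q 0 j).
Proof.
move=> h1 h2; have oO := chart_image_open h1.
exists c, (cmap c @` cdom c); split=> //.
apply: Cinfty_eq (Cinfty_rcoord j oO) => // y [q cq <-] /=.
by rewrite (chart_cancel hM).
Qed.

(** The coordinates of [F] are given in unrelated charts; move them to a common
one and intersect the finitely many domains. *)
Lemma smooth_at_comp_nearby n (F : M -> 'rV[R]_n) (O : set 'rV[R]_n) p :
  (forall j, smooth_at sM p (fun q => F q 0 j)) -> open O -> O (F p) ->
  exists c W, [/\ charts sM c /\ cdom c p, open W /\ W (cmap c p),
    W `<=` cmap c @` cdom c, forall y, W y -> O (F (cinv c y)) &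
    forall j, Cinfty_on W (fun y => F (cinv c y) 0 j : R)].
Proof.
move=> sF oO Op; have [c h1 h2] := charts_cover hM p.
have /choice[ Oj hOj] := fun j => smooth_at_in_chart (sF j) h1 h2.
pose D := cmap c @` cdom c.
pose W := D `&` [set y | forall j, Oj j y].
have oW : open W.
  rewrite openE => y [Dy Wy]; apply: filterI.
    by apply: open_nbhs_nbhs; split=> //; exact: chart_image_open.
  apply: (@filter_forall _ _ Oj (nbhs y)) => j.
  by apply: open_nbhs_nbhs; split; [have [] := hOj j|exact: Wy].
have hW j : Cinfty_on W (fun y => F (cinv c y) 0 j : R).
  by have [_ _ _] := hOj j; apply: Cinfty_sub => y [].
exists c, (W `&` (F \o cinv c) @^-1` O); split=> //; first split.
- apply: open_preimage => // y Wy; apply: differentiable_continuous.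
  have [//] := is_diff_row (g := F \o cinv c) (fun j => Cinfty_differentiable (hW j) Wy).
- split; last by rewrite /= (chart_cancel hM).
  by split; [exists p|move=> j; have [] := hOj j].
- by move=> y [[]].
- by move=> y [].
- by move=> j; apply: Cinfty_sub (hW j) => y [].
Qed.

Lemma smooth_at_comp n (F : M -> 'rV[R]_n) (G : 'rV[R]_n -> R) (O : set 'rV[R]_n) p :
  (forall j, smooth_at sM p (fun q => F q 0 j)) -> open O -> O (F p) -> Cinfty_on O G ->
  smooth_at sM p (G \o F).
Proof.
move=> sF oO Op hG; have [c [W [h [oW Wp] sW FO hW]]] := smooth_at_comp_nearby sF oO Op.
exists c, W; split=> //.
exact: (@Cinfty_comp _ _ _ W O (F \o cinv c) G oW FO hW hG).
Qed.

Lemma nearby_comp n (F : M -> 'rV[R]_n) (O : set 'rV[R]_n) p :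
  (forall j, smooth_at sM p (fun q => F q 0 j)) -> open O -> O (F p) ->
  nearby p (fun q => O (F q)).
Proof.
move=> sF oO Op; have [c [W [h [oW Wp] sW FO hW]]] := smooth_at_comp_nearby sF oO Op.
by exists c, W.
Qed.

Lemma nearby_continuous (f : M -> R) (O : set R) p : smooth_at sM p f -> open O -> O
  (f p) ->
  nearby p (fun q => O (f q)).
Proof.
move=> sf oO Op.
have := @nearby_comp 1 (fun q => \row_(_ < 1) f q) (@rcoord R 1 ord0 @^-1` O) p.
rewrite /preimage /rcoord /= => /(_ _ _ _)/(nearbyS _); apply.
- by move=> q; rewrite mxE.
- move=> j; apply: smooth_at_eq sf; apply: nearbyT => q; by rewrite mxE.
- exact: open_comp (fun x _ => @rcoord_continuous R 1 ord0 x) oO.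
- by rewrite mxE.
Qed.

Lemma smooth_at_cst p (k : R) : smooth_at sM p (fun=> k).
Proof.
have [c h1 h2] := charts_cover hM p.
exists c, (cmap c @` cdom c); split=> //; first exact: chart_image_open.
exact: Cinfty_cst.
Qed.

Lemma smooth_at_pair f g p : smooth_at sM p f -> smooth_at sM p g ->
  exists c W, [/\ charts sM c /\ cdom c p, open W /\ W (cmap c p),
    W `<=` cmap c @` cdom c, Cinfty_on W (f \o cinv c) & Cinfty_on W (g \o cinv c)].
Proof.
move=> [c [W [h oW Wp sW fW]]] /smooth_at_in_chart.
move=> /(_ c h.1 h.2)[W' [oW' Wp' sW' gW]].
exists c, (W `&` W'); split=> //.
- by split; [exact: openI|].
- by move=> y [/sW].
- by apply: Cinfty_sub fW => y [].
- by apply: Cinfty_sub gW => y [].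
Qed.

Lemma smooth_atD f g p : smooth_at sM p f -> smooth_at sM p g ->
  smooth_at sM p (fun q => f q + g q).
Proof.
move=> hf hg; have [c [W [h [oW Wp] sW fW gW]]] := smooth_at_pair hf hg.
by exists c, W; split=> //; exact: CinftyD.
Qed.

Lemma smooth_atM f g p : smooth_at sM p f -> smooth_at sM p g ->
  smooth_at sM p (fun q => f q * g q).
Proof.
move=> hf hg; have [c [W [h [oW Wp] sW fW gW]]] := smooth_at_pair hf hg.
by exists c, W; split=> //; exact: CinftyM.
Qed.

Lemma smooth_atZ f k p : smooth_at sM p f -> smooth_at sM p (fun q => k * f q).
Proof. by move=> hf; apply: smooth_atM => //; exact: smooth_at_cst. Qed.

Lemma smooth_atN f p : smooth_at sM p f -> smooth_at sM p (fun q => - f q).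
Proof.
move=> /(@smooth_atZ _ (- 1)); apply: smooth_at_eq; apply: nearbyT => q.
by rewrite mulN1r.
Qed.

Lemma smooth_atB f g p : smooth_at sM p f -> smooth_at sM p g ->
  smooth_at sM p (fun q => f q - g q).
Proof. by move=> hf hg; apply: smooth_atD => //; exact: smooth_atN. Qed.

Lemma smooth_at_sum (I : Type) (r : seq I) (F : I -> M -> R) p :
  (forall i, smooth_at sM p (F i)) -> smooth_at sM p (fun q => \sum_(i <- r) F i q).
Proof.
move=> hF; elim: r => [|i r IH].
  by apply: smooth_at_eq (smooth_at_cst p 0); apply: nearbyT => q; rewrite big_nil.
by apply: smooth_at_eq (smooth_atD (hF i) IH); apply: nearbyT => q; rewrite big_cons.
Qed.

Lemma smooth_atV f p : smooth_at sM p f -> f p != 0 -> smooth_at sM p (fun q => (f q)^-1).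
Proof.
move=> hf fp0.
have := nearby_continuous hf (@open_neq R 0) fp0.
move: hf => [c [W [h oW Wp sW fW]]] /nearby_in_chart/(_ h.1 h.2)[W' [oW' Wp' _ f0]].
exists c, (W `&` W'); split=> //; first exact: openI.
  by move=> y [/sW].
apply: (@CinftyV _ _ _ (f \o cinv c)); first exact: openI.
  by move=> y [_ /f0].
by apply: Cinfty_sub fW => y [].
Qed.

End SmoothGerms.

(** * Smooth maps, and maps into a product with a coordinate space *)

Section SmoothMaps.
Context {R : realType} {M N : Type} (sM : atlas R M) (sN : atlas R N).
Hypotheses (hM : manifold sM) (hN : manifold sN).

Definition smooth_map_at (p : M) (F : M -> N) :=
  forall g, smooth_at sN (F p) g -> smooth_at sM p (g \o F).

(** Continuity of [F], from the fact that it pulls back smooth germs: apply this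
to a function that vanishes where [P] holds and equals 1 elsewhere. *)
Lemma smooth_map_nearby p F P : smooth_map_at p F -> nearby sN (F p) P ->
  nearby sM p (fun q => P (F q)).
Proof.
move=> hF hP; pose chi y : R := if `[< P y >] then 0 else 1.
have Pp : P (F p) := nearby_self hN hP.
have sch : smooth_at sN (F p) chi.
  apply: (smooth_at_eq hN) (smooth_at_cst hN (F p) 0).
  by apply: nearbyS hP => y Py; rewrite /chi asboolT.
have := nearby_continuous hM (hF _ sch) (@open_lt R 1).
rewrite /= {1}/chi asboolT // ltr01 => /(_ isT).
apply: nearbyS => q /=; rewrite /chi; case: asboolP => //.
by rewrite ltxx.
Qed.

End SmoothMaps.

Section ProductMap.
Context {R : realType} {M N : Type} (sM : atlas R M) (sN : atlas R N) (r : nat).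
Hypotheses (hM : manifold sM) (hN : manifold sN).
Local Notation sP := (prod_atlas sM (euclidean r)).

Lemma smooth_at_prod_coord g m y : smooth_at sP (m, y) g ->
  exists c (O : set 'rV[R]_(mdim sM + r)), [/\ charts sM c /\ cdom c m, open O,
    O (row_mx (cmap c m) y),
    forall z, O z -> exists2 m', cdom c m' & cmap c m' = lsubmx z &
    Cinfty_on O (fun z => g (cinv c (lsubmx z), rsubmx z))].
Proof.
move=> [_ [ O [[[c [d [hc /= -> ->]]] /= [cm _]] oO Op sO gO]]].
exists c, O; split=> // z /sO[[m' y'] /= [cm' _] <-].
by exists m' => //; rewrite row_mxKl.
Qed.

(** [G] and the coordinates [Phi] are kept explicit because the partial derivatives
of [G] in the fibre directions are needed later on. *)
Lemma smooth_at_prod_comp g (F : N -> M) (Psi : N -> 'rV[R]_r) p :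
  smooth_map_at sN sM p F -> (forall j, smooth_at sN p (fun q => Psi q 0 j)) ->
  smooth_at sP (F p, Psi p) g ->
  exists c (O : set 'rV[R]_(mdim sM + r)) (G : 'rV[R]_(mdim sM + r) -> R)
    (Phi := fun q => row_mx (cmap c (F q)) (Psi q)), [/\
    open O /\ Cinfty_on O G,
    forall j, smooth_at sN p (fun q => Phi q 0 j), O (Phi p),
    charts sM c /\ cdom c (F p) &
    forall m y, cdom c m -> G (row_mx (cmap c m) y) = g (m, y)].
Proof.
move=> sF sPsi /smooth_at_prod_coord[c [ O [hc oO Op sO gO]]].
exists c, O, (fun z => g (cinv c (lsubmx z), rsubmx z)); split=> //.
  move=> j; case: (split_ordP j) => k ->.
    have := sF _ (smooth_at_chart hM k hc.1 hc.2); apply: smooth_at_eq => //.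
    by apply: nearbyT => // q; rewrite /= row_mxEl.
  have := sPsi k; apply: smooth_at_eq => //.
  by apply: nearbyT => // q; rewrite /= row_mxEr.
by move=> m y cm; rewrite row_mxKl row_mxKr (chart_cancel hM hc.1 cm).
Qed.

Lemma smooth_at_prod g (F : N -> M) (Psi : N -> 'rV[R]_r) p :
  smooth_map_at sN sM p F -> (forall j, smooth_at sN p (fun q => Psi q 0 j)) ->
  smooth_at sP (F p, Psi p) g -> smooth_at sN p (fun q => g (F q, Psi q)).
Proof.
move=> sF sPsi /(smooth_at_prod_comp sF sPsi)[c [ O [G [[oO GO] sPhi Op hc Gg]]]].
apply: smooth_at_eq (smooth_at_comp hN sPhi oO Op GO) => //.
have := nearby_chart hM hc.1 hc.2.
move/(smooth_map_nearby hN hM sF); apply: nearbyS => q cq /=.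
exact: Gg.
Qed.

Lemma smooth_at_fst g m (y : 'rV[R]_r) : smooth_at sM m g -> smooth_at sP (m, y)
  (g \o fst).
Proof.
move=> [c [ O [[h1 h2] oO Op sO gO]]].
exists (prod_chart c (Chart setT id id)), (lsubmx @^-1` O); split=> /=.
- split=> //; exists c, (Chart setT id id); split=> //.
- apply: open_comp oO => z _; exact: continuous_lsubmx.
- by rewrite row_mxKl.
- move=> z /sO[m' cm' E]; exists (m', rsubmx z) => //=.
  by rewrite E hsubmxK.
- have oO' : open ((lsubmx : 'rV[R]_(mdim sM + r) -> _) @^-1` O).
    by apply: open_comp oO => z _; exact: continuous_lsubmx.
  apply: (@Cinfty_comp _ _ _ _ O lsubmx (g \o cinv c)) => // j.
  apply: Cinfty_eq (Cinfty_rcoord (lshift r j) oO') => // z _.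
  by rewrite /rcoord mxE.
Qed.

Lemma smooth_at_snd j m (y : 'rV[R]_r) : smooth_at sP (m, y) (fun q => q.2 0 j).
Proof.
have [c h1 h2] := charts_cover hM m.
have oO := chart_image_open hM h1.
have oO' : open ((lsubmx : 'rV[R]_(mdim sM + r) -> _) @^-1` (cmap c @` cdom c)).
  by apply: open_comp oO => z _; exact: continuous_lsubmx.
exists (prod_chart c (Chart setT id id)), (lsubmx @^-1` (cmap c @` cdom c)); split=> /=.
- split=> //; exists c, (Chart setT id id); split=> //.
- exact: oO'.
- by rewrite row_mxKl; exists m.
- move=> z [m' cm' E]; exists (m', rsubmx z) => //=.
  by rewrite E hsubmxK.
- apply: Cinfty_eq (Cinfty_rcoord (rshift _ j) oO') => // z _.
  by rewrite /rcoord /= mxE.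
Qed.

End ProductMap.

(** * Tangent vectors and the chain rule for derivations *)

Section HadamardRow.
Context {R : realType} {n : nat}.

Lemma Hadamard_row (p : 'rV[R]_n) (d : R) (f : 'rV[R]_n -> R) (i : 'I_n) : 0 < d ->
  Cinfty_on (ball p d) f -> exists g : 'rV[R]_n -> R,
  [/\ Cinfty_on (ball p d) g, g p = 'D_(delta_mx 0 i) f p,
    forall x, ball p d x -> ball p d (x - (x 0 i - p 0 i) *: delta_mx 0 i) &
    forall x, f x = f (x - (x 0 i - p 0 i) *: delta_mx 0 i) + (x 0 i - p 0 i) * g x].
Proof.
move=> d0 hf.
have le1 : rcoord i (delta_mx 0 i : 'rV[R]_n) = 1 by rewrite /rcoord mxE !eqxx.
have hE x : slice_coord (rcoord i) p x =
  x 0 i - p 0 i by rewrite /slice_coord /= /rcoord !mxE.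
have segB (x : 'rV[R]_n) : ball p d x -> forall t : R, 0 <= t <= 1 ->
    ball p d (slice_proj (rcoord i) (delta_mx 0 i) p x +
      t *: (slice_coord (rcoord i) p x *: (delta_mx 0 i : 'rV[R]_n))).
  move=> [_ Bx] t /andP[t0 t1]; split=> // a b; have := Bx a b.
  rewrite /slice_proj hE !ord1 !mxE eqxx /= /ball /=.
  case: (eqVneq b i) => [->|bi]; last by rewrite !mulr0 subr0 addr0.
  rewrite mulr1 subKr opprD addrA subrr add0r normrN normrM ger0_norm // distrC.
  by apply: le_lt_trans; rewrite ler_piMl.
have [g [hg fg g0]] := Hadamard (@rcoord_continuous R n i) le1
  (ball_open p d) segB hf.
exists g; split=> //.
- by apply: g0; rewrite hE subrr.
- move=> x Bx; have := segB x Bx 0.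
  by rewrite scale0r addr0 /slice_proj hE lexx ler01; apply.
- by move=> x; rewrite fg /slice_proj hE.
Qed.

End HadamardRow.

Section Tangent.
Context {R : realType} {M : Type} (sM : atlas R M).
Hypothesis (hM : manifold sM).
Variable (p : M).
Implicit Types (v w : tvector R M) (f g : M -> R).

Lemma on_germs_smooth v f : smooth_at sM p f -> on_germs sM p v f = v f.
Proof. by move=> h; rewrite /on_germs asboolT. Qed.

Lemma tangentfD v f g : tangent sM p v -> smooth_at sM p f -> smooth_at sM p g ->
  v (fun q => f q + g q) = v f + v g.
Proof.
move=> tv hf hg; rewrite -[v f]mul1r -(tangent_linear tv) //.
by congr v; apply/funext => q; rewrite !fctE scale1r.
Qed.

Lemma tangentfM v f g : tangent sM p v -> smooth_at sM p f -> smooth_at sM p g ->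
  v (fun q => f q * g q) = f p * v g + g p * v f.
Proof. by move=> tv hf hg; rewrite -(tangent_leibniz tv). Qed.

Lemma tangent_cst v (k : R) : tangent sM p v -> v (fun=> k) = 0.
Proof.
move=> tv; have s c := smooth_at_cst hM p c.
have v0 : v (fun=> 0) = 0.
  have := tangentfD tv (s 0) (s 0); rewrite (_ : (fun _ => _) = fun=> 0); last first.
    by apply/funext => q; rewrite addr0.
  by move/eqP; rewrite -subr_eq0 opprD addrA subrr add0r oppr_eq0 => /eqP.
have v1 : v (fun=> 1) = 0.
  have := tangentfM tv (s 1) (s 1); rewrite (_ : (fun _ => _) = fun=> 1); last first.
    by apply/funext => q; rewrite mulr1.
  by rewrite mul1r => /eqP; rewrite -subr_eq0 opprD addrA subrr add0r oppr_eq0 => /eqP.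
rewrite (_ : (fun=> k) = k *: (fun=> 1 : R) + (fun=> 0)).
  by rewrite (tangent_linear tv) // v1 v0 mulr0 addr0.
by apply/funext => q; rewrite !fctE addr0 /GRing.scale /= mulr1.
Qed.

Lemma tangentfZ v (k : R) f : tangent sM p v -> smooth_at sM p f ->
  v (fun q => k * f q) = k * v f.
Proof.
move=> tv hf; rewrite (tangentfM tv
  (smooth_at_cst hM p k) hf) tangent_cst // mulr0 addr0 //.
Qed.

Lemma tangentfN v f : tangent sM p v -> smooth_at sM p f -> v (fun q => - f q) = - v f.
Proof.
move=> tv hf; rewrite -mulN1r -tangentfZ //; congr v; apply/funext => q;
  by rewrite mulN1r.
Qed.

Lemma tangentfB v f g : tangent sM p v -> smooth_at sM p f -> smooth_at sM p g ->
  v (fun q => f q - g q) = v f - v g.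
Proof. by move=> tv hf hg; rewrite (tangentfD tv hf (smooth_atN hM hg)) tangentfN. Qed.

(** A derivation only sees germs: if [f - g] vanishes near [p], then
[f - g = (f - g) chi] with [chi] smooth at [p] and zero near [p], and the
Leibniz rule kills this product. *)
Lemma tangent_eq v f g : tangent sM p v -> nearby sM p (fun q => f q = g q) -> v f = v g.
Proof.
move=> tv E; case: (pselect (smooth_at sM p f)) => [hf|nf]; last first.
  rewrite !(tangent_germ tv) // => hg; apply: nf; apply: (smooth_at_eq hM) hg.
  by apply: nearbyS E.
have hg := smooth_at_eq hM E hf.
pose chi q : R := if f q == g q then 0 else 1.
have hchi : smooth_at sM p chi.
  apply: (smooth_at_eq hM) (smooth_at_cst hM p 0).
  by apply: nearbyS E => q /= e; rewrite /chi e eqxx.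
have := tangentfM tv (smooth_atB hM hf hg) hchi.
rewrite (_ : (fun _ => _) = fun q => f q - g q); last first.
  by apply/funext => q; rewrite /chi; case: eqP => [->|]; rewrite ?subrr ?mul0r ?mulr1.
have fgp : f p = g p := nearby_self hM E.
by rewrite tangentfB // /chi fgp eqxx subrr !mul0r addr0 => /eqP; rewrite subr_eq0 =>
  /eqP.
Qed.

Lemma tangent_ext v w : tangent sM p v -> tangent sM p w ->
  (forall f, smooth_at sM p f -> v f = w f) -> v = w.
Proof.
move=> tv tw h; apply/funext => f; case: (pselect (smooth_at sM p f)) => [/h//|nf].
by rewrite !(tangent_germ _ nf).
Qed.

Lemma tangent_on_germs v :
  (forall (k : R) f g, smooth_at sM p f -> smooth_at sM p g ->
    v (k *: f + g) = k * v f + v g) ->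
  (forall f g, smooth_at sM p f -> smooth_at sM p g ->
    v (f \* g) = f p * v g + g p * v f) -> tangent sM p (on_germs sM p v).
Proof.
move=> hl hm; split=> [k f g hf hg|f g hf hg|f nf].
- rewrite !on_germs_smooth //; first exact: hl.
  apply: smooth_atD => //; exact: smooth_atZ.
- rewrite !on_germs_smooth //; first exact: hm.
  exact: smooth_atM.
- by rewrite /on_germs asboolF.
Qed.

Lemma tangentZD v w (k : R) : tangent sM p v -> tangent sM p w -> tangent sM p
  (k *: v + w).
Proof.
move=> tv tw; split=> [c f g hf hg|f g hf hg|f nf]; rewrite !fctE.
- rewrite (tangent_linear tv c hf hg) (tangent_linear tw c hf hg) /GRing.scale /=; ring.
- rewrite (tangent_leibniz tv hf hg) (tangent_leibniz tw hf hg) /GRing.scale /=; ring.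
- by rewrite !(tangent_germ _ nf) // scaler0 addr0.
Qed.

Lemma tangent0 : tangent sM p 0.
Proof.
have z h : (0 : tvector R M) h = 0 by [].
by split=> [c f g hf hg|f g hf hg|f nf]; rewrite !z ?mulr0 ?addr0.
Qed.

Lemma tangentD v w : tangent sM p v -> tangent sM p w -> tangent sM p (v + w).
Proof. by move=> tv tw; rewrite -[v]scale1r; exact: tangentZD. Qed.

Lemma tangentB v w : tangent sM p v -> tangent sM p w -> tangent sM p (v - w).
Proof. by move=> tv tw; rewrite addrC -scaleN1r; exact: tangentZD. Qed.

(** Dividing by the [i]-th coordinate writes [G] as its restriction to a slice plus
a product whose first factor vanishes at [F p]; the Leibniz rule leaves only
the value of the quotient there, a partial derivative of [G]. *)
Lemma tangent_chain_step n (F : M -> 'rV[R]_n) (G : 'rV[R]_n -> R) (d : R) v i :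
  tangent sM p v -> (forall j, smooth_at sM p (fun q => F q 0 j)) -> 0 < d ->
  Cinfty_on (ball (F p) d) G ->
  v (G \o F) = v (fun q => F q 0 i) * 'D_(delta_mx 0 i) G (F p) +
    v (fun q => G (F q - (F q 0 i - F p 0 i) *: delta_mx 0 i)).
Proof.
move=> tv sF d0 hG; have [g [hg gp stab E]] := Hadamard_row i d0 hG.
have oB := ball_open (F p) d.
have sg := smooth_at_comp hM sF oB (ballxx _ d0) hg.
have sFi := smooth_atB hM (sF i) (smooth_at_cst hM p (F p 0 i)).
have sG : smooth_at sM p (fun q => G (F q - (F q 0 i - F p 0 i) *: delta_mx 0 i)).
  apply: (@smooth_at_comp _ _ _ hM _
    (fun q => F q - (F q 0 i - F p 0 i) *: delta_mx 0 i) G (ball (F p) d)) => //.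
  - move=> j; apply: (smooth_at_eq hM)
    (smooth_atB hM (sF j) (smooth_atZ hM ((delta_mx 0 i : 'rV[R]_n) 0 j) sFi)).
    by apply: nearbyT => // q; rewrite !mxE mulrC.
  - by apply: stab; exact: ballxx.
have -> : G \o F = fun q => G (F q - (F q 0 i - F p 0 i) *: delta_mx 0 i) +
    (F q 0 i - F p 0 i) * g (F q) by apply/funext => q /=; exact: E.
rewrite (tangentfD tv sG (smooth_atM hM sFi sg))
  (tangentfM tv sFi sg) /= subrr mul0r add0r.
rewrite (tangentfB tv (sF i) (smooth_at_cst hM p _)) tangent_cst // subr0 gp addrC.
by congr (_ + _); rewrite mulrC.
Qed.

(** The coordinates are frozen one after the other; when all of them are, the
function is constant. *)
Lemma tangent_chain n (F : M -> 'rV[R]_n) (G : 'rV[R]_n -> R) (O : set 'rV[R]_n) v :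
  tangent sM p v -> (forall j, smooth_at sM p (fun q => F q 0 j)) -> open O -> O (F p) ->
  Cinfty_on O G ->
  v (G \o F) = \sum_i v (fun q => F q 0 i) * 'D_(delta_mx 0 i) G (F p).
Proof.
move=> tv sF oO Op hG.
have /nbhs_ballP[d /= d0 hd] : nbhs (F p) O by exact: open_nbhs_nbhs.
have {}hG : Cinfty_on (ball (F p) d) G by exact: Cinfty_sub hG.
(* the coordinates in [s] are frozen at their value at [p] *)
pose P (s : seq 'I_n) q : 'rV[R]_n := \row_j (if j \in s then F p 0 j else F q 0 j).
have Pp s : P s p = F p by apply/rowP => j; rewrite mxE if_same.
suff H s : uniq s -> v (G \o F) = \sum_(i <- s) v
  (fun q => F q 0 i) * 'D_(delta_mx 0 i) G (F p) + v (G \o P s).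
  rewrite (H _ (index_enum_uniq _)) [X in _ + X](_ : _ = 0) ?addr0 //.
  rewrite (_ : G \o _ = fun=> G (F p)) ?tangent_cst //; apply/funext => q /=.
  by congr G; apply/rowP => j; rewrite mxE mem_index_enum.
elim: s => [_|i s IH /= /andP[si us]].
  rewrite big_nil add0r; congr (v (G \o _)); apply/funext => q; apply/rowP => j.
  by rewrite mxE.
rewrite (IH us) big_cons (@tangent_chain_step n (P s) G d v i) ?Pp //.
  rewrite addrCA addrA; congr (_ * _ + _ + _); last first.
    congr v; apply/funext => q /=; congr G; apply/rowP => j; rewrite !mxE !eqxx /= inE.
    case: (eqVneq j i) => [->|ji]; last by rewrite mulr0 subr0.
    by rewrite (negbTE si) mulr1 subKr.
  by congr v; apply/funext => q; rewrite mxE (negbTE si).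
move=> j; case: (boolP (j \in s)) => js.
  apply: (smooth_at_eq hM) (smooth_at_cst hM p (F p 0 j)); apply: nearbyT => // q.
  by rewrite mxE js.
apply: (smooth_at_eq hM) (sF j); apply: nearbyT => // q.
by rewrite mxE (negbTE js).
Qed.

End Tangent.

(** * Vector fields, brackets and related fields *)

Section Fields.
Context {R : realType} {M : Type} (sM : atlas R M).
Hypothesis (hM : manifold sM).
Implicit Types (X Y Z : M -> tvector R M).

Definition smooth_field_at p X := nearby sM p (fun q => tangent sM q (X q)) /\
  forall g, smooth_at sM p g -> smooth_at sM p (fun q => X q g).

Lemma vfield_smooth_at W X p : mopen sM W -> W p -> vfield sM W X -> smooth_field_at p X.
Proof.
move=> oW Wp hX; split; last by have [] := hX p Wp.
by apply: nearbyS (nearby_mopen hM oW Wp) => q /hX[].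
Qed.

Lemma smooth_field_tangent p X : smooth_field_at p X -> tangent sM p (X p).
Proof. by move=> [hX _]; exact: (nearby_self hM hX). Qed.

Lemma bracketE p X Y f : smooth_at sM p f ->
  bracket sM X Y p f = X p (fun q => Y q f) - Y p (fun q => X q f).
Proof. by move=> hf; rewrite /bracket on_germs_smooth. Qed.

Lemma field_linear p X Y (k : R) f g : smooth_field_at p X -> smooth_field_at p Y ->
  smooth_at sM p f -> smooth_at sM p g ->
  X p (fun q => Y q (k *: f + g)) = k * X p (fun q => Y q f) + X p (fun q => Y q g).
Proof.
move=> hX hY hf hg; have tX := smooth_field_tangent hX.
have [tY sY] := hY.
rewrite (@tangent_eq _ _ _ hM p _ _ (fun q => k * Y q f + Y q g) tX); last first.
  have := nearbyI hM tY (nearbyI hM (smooth_at_nearby hM hf) (smooth_at_nearby hM hg)).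
  by apply: nearbyS => q [tq [fq gq]]; rewrite (tangent_linear tq).
by rewrite (tangentfD tX (smooth_atZ hM k (sY _ hf)) (sY _ hg))
  (tangentfZ hM k tX (sY _ hf)).
Qed.

(** In the bracket of two fields, the terms that mix their first derivatives are
symmetric and cancel. *)
Lemma field_leibniz p X Y f g : smooth_field_at p X -> smooth_field_at p Y ->
  smooth_at sM p f -> smooth_at sM p g ->
  X p (fun q => Y q (f \* g)) = X p f * Y p g + f p * X p (fun q => Y q g)
    + X p g * Y p f + g p * X p (fun q => Y q f).
Proof.
move=> hX hY hf hg; have tX := smooth_field_tangent hX.
have [tY sY] := hY.
rewrite (@tangent_eq _ _ _ hM p _ _ (fun q => f q * Y q g + g q * Y q f) tX); last first.
  have := nearbyI hM tY (nearbyI hM (smooth_at_nearby hM hf) (smooth_at_nearby hM hg)).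
  by apply: nearbyS => q [tq [fq gq]]; rewrite (tangent_leibniz tq).
rewrite (tangentfD tX (smooth_atM hM hf (sY _ hg)) (smooth_atM hM hg (sY _ hf))).
rewrite (tangentfM tX hf (sY _ hg)) (tangentfM tX hg (sY _ hf)); ring.
Qed.

Lemma bracket_tangent p X Y : smooth_field_at p X -> smooth_field_at p Y ->
  tangent sM p (bracket sM X Y p).
Proof.
move=> hX hY; apply: tangent_on_germs => // [k f g hf hg|f g hf hg].
  by rewrite !field_linear //; ring.
by rewrite !field_leibniz //; ring.
Qed.

Lemma bracket_eq p X X' Y Y' : smooth_field_at p X -> smooth_field_at p Y ->
  nearby sM p (fun q => X q = X' q) -> nearby sM p (fun q => Y q = Y' q) ->
  bracket sM X Y p = bracket sM X' Y' p.
Proof.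
move=> hX hY EX EY; have tX := smooth_field_tangent hX; have tY :=
  smooth_field_tangent hY.
rewrite /bracket /on_germs; apply/funext => f; case: asboolP => // hf.
rewrite -(nearby_self hM EX) -(nearby_self hM EY); congr (_ - _).
  by apply: tangent_eq tX _ => //; apply: nearbyS EY => q /= ->.
by apply: tangent_eq tY _ => //; apply: nearbyS EX => q /= ->.
Qed.

(** The Leibniz rule of the bracket in its second argument. A germwise equality of
fields is what the vertical lift of a decomposed section provides. *)
Lemma bracket_leibniz p X Y Z Y' (h : M -> R) : smooth_field_at p X ->
  smooth_field_at p Y ->
  smooth_field_at p Z -> smooth_at sM p h ->
  nearby sM p (fun q => Y' q = Y q + h q *: Z q) ->
  bracket sM X Y' p = bracket sM X Y p + X p h *: Z p + h p *: bracket sM X Z p.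
Proof.
move=> hX hY hZ hh E; have tX := smooth_field_tangent hX.
have [tY sY] := hY; have [tZ sZ] := hZ.
apply/funext => f; rewrite !fctE; case: (pselect (smooth_at sM p f)) => hf; last first.
  by rewrite /bracket /on_germs asboolF //
    (tangent_germ (nearby_self hM tZ) hf) !scaler0 !addr0.
rewrite !bracketE // (nearby_self hM E).
rewrite (@tangent_eq _ _ _ hM p _ _ (fun q => Y q f + h q * Z q f) tX); last first.
  by apply: nearbyS E => q /= ->.
rewrite (tangentfD tX (sY _ hf) (smooth_atM hM hh (sZ _ hf))) (tangentfM tX hh (sZ _ hf)).
rewrite !fctE /GRing.scale /=; ring.
Qed.

End Fields.

Section Pushforward.
Context {R : realType} {M N : Type} (sM : atlas R M) (sN : atlas R N) (F : M -> N).
Hypothesis (hM : manifold sM) (hN : manifold sN).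

Lemma pushforwardE p v g : smooth_at sN (F p) g -> pushforward sN F p v g = v (g \o F).
Proof. by move=> hg; rewrite /pushforward on_germs_smooth. Qed.

Lemma pushforward_tangent p v : smooth_map_at sM sN p F -> tangent sM p v ->
  tangent sN (F p) (pushforward sN F p v).
Proof.
move=> sF tv; apply: tangent_on_germs => // [k f g hf hg|f g hf hg].
  by rewrite -(tangent_linear tv _ (sF _ hf) (sF _ hg)).
by rewrite -(tangent_leibniz tv (sF _ hf) (sF _ hg)).
Qed.

Lemma pushforwardZD p (k : R) v w :
  pushforward sN F p (k *: v + w) = k *: pushforward sN F p v + pushforward sN F p w.
Proof.
apply/funext => g; rewrite !fctE /pushforward /on_germs; case: asboolP => // _.
by rewrite scaler0 addr0.
Qed.

Lemma bracket_related p X Y X' Y' : smooth_map_at sM sN p F ->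
  smooth_field_at sM p X -> smooth_field_at sM p Y ->
  smooth_field_at sN (F p) X' -> smooth_field_at sN (F p) Y' ->
  nearby sM p (fun q => X' (F q) = pushforward sN F q (X q)) ->
  nearby sM p (fun q => Y' (F q) = pushforward sN F q (Y q)) ->
  bracket sN X' Y' (F p) = pushforward sN F p (bracket sM X Y p).
Proof.
move=> sF hX hY hX' hY' EX EY.
have tX := smooth_field_tangent hM hX; have tY := smooth_field_tangent hM hY.
apply/funext => g; rewrite /bracket /pushforward /on_germs; case: asboolP => // hg.
rewrite asboolT; last exact: sF.
rewrite (nearby_self hM EX) (nearby_self hM EY).
have ng := smooth_map_nearby hM hN sF (smooth_at_nearby hN hg).
rewrite (pushforwardE _ (hY'.2 _ hg)) (pushforwardE _ (hX'.2 _ hg)); congr (_ - _).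
  apply: (tangent_eq hM tX); apply: nearbyS (nearbyI hM EY ng) => q /= [-> gq].
  exact: pushforwardE.
apply: (tangent_eq hM tY); apply: nearbyS (nearbyI hM EX ng) => q /= [-> gq].
exact: pushforwardE.
Qed.

End Pushforward.

(** * Vertical vectors of a bundle *)

Section LinearMaps.
Context {R : realType} {X Y : lmodType R} (f : X -> Y) (lf : linear f).

Lemma linear_map0 : f 0 = 0.
Proof.
have := lf 1 0 0; rewrite !scale1r addr0 => /eqP.
by rewrite -subr_eq0 opprD addrA subrr add0r oppr_eq0 => /eqP.
Qed.

Lemma linear_mapZ k x : f (k *: x) = k *: f x.
Proof. by rewrite -[k *: x]addr0 lf linear_map0 addr0. Qed.

Lemma linear_mapD x y : f (x + y) = f x + f y.
Proof. by rewrite -[x]scale1r lf !scale1r. Qed.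

End LinearMaps.

Section VerticalLift.
Context {R : realType} {M : Type} (sM : atlas R M) {F : M -> Type} {V : M -> lmodType R}.
Context (add : forall m, F m -> V m -> F m) (sF : atlas R {m : M & F m}).
Local Notation total := {m : M & F m}.
Local Notation proj := (@projT1 M F).
Local Notation vlift := (vlift add sF).

(** A local trivialization of the bundle [F] together with one of the vector
bundle [V] acting on its fibres. It covers both an affine bundle and a vector
bundle acting on itself by addition, so that the results on vertical vectors
are proved once. *)
Record fibre_chart (r : nat) (U : set M) (c : forall m, F m -> 'rV[R]_r)
    (c' : forall m, 'rV[R]_r -> F m) (l : forall m, V m -> 'rV[R]_r)
    (l' : forall m, 'rV[R]_r -> V m) : Prop := {
  fibre_triv : trivialization sM sF U c c';
  fibre_linear : forall m, U m -> linear (@l m);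
  fibre_cancel : forall m, U m -> cancel (@l m) (@l' m) /\ cancel (@l' m) (@l m);
  fibre_add : forall m, U m -> forall a v, c m (add a v) = c m a + l m v }.

Hypotheses (hM : manifold sM) (hF : manifold sF).
Context (r : nat) (U : set M) (c : forall m, F m -> 'rV[R]_r)
    (c' : forall m, 'rV[R]_r -> F m) (l : forall m, V m -> 'rV[R]_r)
    (l' : forall m, 'rV[R]_r -> V m).
Hypothesis hc : fibre_chart U c c' l l'.

Definition fibre_coord (i : 'I_r) (z : total) : R := c (projT2 z) 0 i.

Lemma proj_smooth z : U (proj z) -> smooth_map_at sF sM z proj.
Proof.
move=> Uz g hg; have [_ _ st _] := fibre_triv hc.
exact: (st z Uz _ (smooth_at_fst (c (projT2 z)) hg)).
Qed.

Lemma fibre_coord_smooth i z : U (proj z) -> smooth_at sF z (fibre_coord i).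
Proof.
move=> Uz; have [_ _ st _] := fibre_triv hc.
exact: (st z Uz _ (smooth_at_snd hM i (proj z) (c (projT2 z)))).
Qed.

Lemma nearby_fibre z : U (proj z) -> nearby sF z (fun z' => U (proj z')).
Proof.
move=> Uz; have [oU _ _ _] := fibre_triv hc.
exact: (smooth_map_nearby hF hM (proj_smooth Uz) (nearby_mopen hM oU Uz)).
Qed.

(** In the coordinates of the base and of the fibre, [g] becomes a smooth function
of finitely many variables, and the [G i] are its partial derivatives in the
fibre directions. The same functions express the derivative of [g] along
vertical lines, at all nearby points, and the value on [g] of a derivation
killed by the projection. *)
Lemma vertical_formula z g : U (proj z) -> smooth_at sF z g ->
  exists G : 'I_r -> total -> R, [/\ forall i, smooth_at sF z (G i),
    nearby sF z (fun z' => forall b : V (proj z'), is_derive (0 : R) 1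
      (fun s => g (existT F (proj z') (add (projT2 z') (s *: b))))
      (\sum_i l b 0 i * G i z')) &
    forall v, tangent sF z v ->
      (forall h, smooth_at sM (proj z) h -> v (h \o proj) = 0) ->
      v g = \sum_i v (fibre_coord i) * G i z].
Proof.
move=> Uz hg; have [oU cc' _ st] := fibre_triv hc.
have hg' : smooth_at (prod_atlas sM (euclidean r)) (proj z, c (projT2 z))
    (g \o (fun q => existT F q.1 (c' q.1 q.2))).
  apply: st => //=; case: z Uz hg => m x /= Um hg.
  by rewrite (cc' m Um).1.
have sc i : smooth_at sF z (fun q => c (projT2 q) 0 i) := fibre_coord_smooth i Uz.
have [d [ O [G [[oO hG] sPhi Op [hd1 hd2] Gg]]]] :=
  smooth_at_prod_comp hM hF (proj_smooth Uz) sc hg'.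
pose Phi q := row_mx (cmap d (proj q)) (c (projT2 q)).
have nO : nearby sF z (fun q => [/\ O (Phi q), U (proj q) & cdom d (proj q)]).
  have n1 := nearby_comp hF sPhi oO Op.
  have n2 := smooth_map_nearby hF hM (proj_smooth Uz) (nearby_chart hM hd1 hd2).
  by apply: nearbyS (nearbyI hF n1 (nearbyI hF (nearby_fibre Uz) n2)) => q [? []].
have dG i : Cinfty_on O ('D_(delta_mx 0 (rshift (mdim sM) i)) G) by exact: Cinfty_derive.
exists (fun i q => 'D_(delta_mx 0 (rshift (mdim sM) i)) G (Phi q)); split.
- by move=> i; exact: (smooth_at_comp hF sPhi oO Op (dG i)).
- apply: nearbyS nO => q [Oq Uq dq] b.
  have -> : (fun s : R => g (existT F (proj q) (add (projT2 q) (s *: b)))) =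
      (fun s => G (Phi q + s *: row_mx 0 (l b))).
    apply/funext => s; rewrite /Phi scale_row_mx scaler0 add_row_mx addr0 Gg //=.
    have -> : c (projT2 q) + s *: l b = c (add (projT2 q) (s *: b)).
      by rewrite (fibre_add hc) // (linear_mapZ (fibre_linear hc Uq)).
    by rewrite (cc' _ Uq).1.
  have dGq := Cinfty_differentiable hG Oq.
  have := is_derive_line0 (row_mx 0 (l b)) dGq.
  rewrite [X in is_derive _ _ _ X -> _](_ : _ =
    \sum_i l b 0 i * 'D_(delta_mx 0 (rshift (mdim sM) i)) G (Phi q)) //.
  rewrite deriveE //.
  have -> : row_mx 0 (l b) = \sum_i l b 0 i *:
    (delta_mx 0 (rshift (mdim sM) i) : 'rV[R]_(mdim sM + r)).
    apply/rowP => j; rewrite summxE; case: (split_ordP j) => k ->.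
      rewrite row_mxEl mxE big1 // => i _.
      by rewrite !mxE eqxx eq_lrshift mulr0.
    rewrite row_mxEr (bigD1 k) //= !mxE !eqxx mulr1 big1 ?addr0 // => i ik.
    by rewrite !mxE eqxx eq_rshift eq_sym (negbTE ik) mulr0.
  rewrite linear_sum; apply: eq_bigr => i _; rewrite linearZ /= -deriveE //.
- move=> v tv hv.
  rewrite (@tangent_eq _ _ _ hF z v g (G \o Phi) tv); last first.
    apply: nearbyS nO => q [Oq Uq dq]; rewrite /= Gg //= (cc' _ Uq).1.
    by case: q {Oq Uq dq}.
  rewrite (tangent_chain hF tv sPhi oO Op hG) big_split_ord /= big1 ?add0r => [|i _].
    apply: eq_bigr => i _; congr (v _ * _); apply/funext => q.
    by rewrite row_mxEr.
  rewrite [X in v X](_ : _ = (fun m => cmap d m 0 i) \o proj) ?hv ?mul0r //.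
    exact: smooth_at_chart.
  by apply/funext => q; rewrite row_mxEl.
Qed.

Lemma vlift_is_derive z (b : V (proj z)) g : U (proj z) -> smooth_at sF z g ->
  is_derive (0 : R) 1 (fun s => g (existT F (proj z) (add (projT2 z) (s *: b))))
    (vlift b g).
Proof.
move=> Uz hg; have [G [_ /(nearby_self hF)/(_ b) d _]] := vertical_formula Uz hg.
by rewrite /vlift on_germs_smooth // derive1E; apply: DeriveDef; case: d.
Qed.

Lemma vliftE z (b : V (proj z)) g d : smooth_at sF z g ->
  is_derive (0 : R) 1 (fun s => g (existT F (proj z) (add (projT2 z) (s *: b)))) d ->
  vlift b g = d.
Proof. by move=> hg [_ <-]; rewrite /vlift on_germs_smooth // derive1E. Qed.

Lemma vlift_formula z g : U (proj z) -> smooth_at sF z g ->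
  exists G : 'I_r -> total -> R, [/\ forall i, smooth_at sF z (G i),
    nearby sF z (fun z' => forall b : V (proj z'), vlift b g = \sum_i l b 0 i * G i z') &
    forall v, tangent sF z v ->
      (forall h, smooth_at sM (proj z) h -> v (h \o proj) = 0) ->
      v g = \sum_i v (fibre_coord i) * G i z].
Proof.
move=> Uz hg; have [G [sG E hv]] := vertical_formula Uz hg.
exists G; split=> //; apply: nearbyS (nearbyI hF E (smooth_at_nearby hF hg)).
by move=> q [d gq] b; exact: vliftE (d b).
Qed.

Lemma vlift_tangent z (b : V (proj z)) : U (proj z) -> tangent sF z (vlift b).
Proof.
move=> Uz; split=> [k f g hf hg|f g hf hg|f nf].
- apply: vliftE; first by apply: smooth_atD => //; exact: smooth_atZ.
  exact: (is_deriveD (is_deriveZ k (vlift_is_derive b Uz hf)) (vlift_is_derive b Uz hg)).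
- apply: vliftE; first exact: smooth_atM.
  have := is_deriveM (vlift_is_derive b Uz hf) (vlift_is_derive b Uz hg).
  have -> : existT F (proj z) (add (projT2 z) ((0 : R) *: b)) = z.
    have [oU cc' _ _] := fibre_triv hc.
    rewrite scale0r; case: z Uz b hf hg => m x /= Um b _ _; congr existT.
    apply: (can_inj (cc' m Um).1).
    by rewrite (fibre_add hc) // (linear_map0 (fibre_linear hc Um)) addr0.
  exact.
- by rewrite /vlift /on_germs asboolF.
Qed.

Lemma vlift_proj z (b : V (proj z)) h : vlift b (h \o proj) = 0.
Proof.
rewrite /vlift /on_germs; case: asboolP => // _.
exact: (derive1_cst (h (proj z)) (0 : R)).
Qed.

Lemma vlift_fibre_coord z (b : V (proj z)) i : U (proj z) -> vlift b (fibre_coord i) =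
  l b 0 i.
Proof.
move=> Uz; apply: vliftE; first exact: fibre_coord_smooth.
have -> : (fun s : R => fibre_coord i (existT F (proj z) (add (projT2 z) (s *: b)))) =
    (fun s => c (projT2 z) 0 i + s *: (l b 0 i : R)).
  apply/funext => s; rewrite /fibre_coord /= (fibre_add hc) //.
  by rewrite (linear_mapZ (fibre_linear hc Uz)) !mxE.
have [did _] := is_diff_id (c (projT2 z) 0 i : R).
by have := is_derive_line0 (l b 0 i : R) did; rewrite derive_id.
Qed.

Lemma vlift_linear z (b b' : V (proj z)) (k : R) : U (proj z) ->
  vlift (k *: b + b') = k *: vlift b + vlift b'.
Proof.
move=> Uz; apply: (tangent_ext (vlift_tangent _ Uz)) => [|g hg].
  by apply: tangentZD; exact: vlift_tangent.
have [G [_ /(nearby_self hF) E _]] := vlift_formula Uz hg.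
rewrite !fctE !E /GRing.scale /= mulr_sumr -big_split /=; apply: eq_bigr => i _.
by rewrite (fibre_linear hc Uz) !mxE mulrDl mulrA.
Qed.

(** Only the fibre coordinates of the section enter, through the formula for
vertical lifts. *)
Lemma section_vlift_smooth (b : forall z, V (proj z)) z : U (proj z) ->
  (forall i, smooth_at sF z (fun q => l (b q) 0 i)) ->
  smooth_field_at sF z (section_vlift add sF b).
Proof.
move=> Uz sb; split.
  by apply: nearbyS (nearby_fibre Uz) => q Uq; exact: vlift_tangent.
move=> g hg; have [G [sG E _]] := vlift_formula Uz hg.
apply: (smooth_at_eq hF) (smooth_at_sum hF (index_enum 'I_r)
  (fun i => smooth_atM hF (sb i) (sG i))).
by apply: nearbyS E => q /= Eq; rewrite /section_vlift Eq.
Qed.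

(** Both sides have the same fibre coordinates and kill the functions of the base;
the formula for vertical vectors then gives the same value on every function. *)
Lemma vertical_tangent z v : U (proj z) -> tangent sF z v ->
  (forall h, smooth_at sM (proj z) h -> v (h \o proj) = 0) ->
  v = vlift (l' (proj z) (\row_i v (fibre_coord i))).
Proof.
move=> Uz tv hv; apply: (tangent_ext tv (vlift_tangent _ Uz)) => g hg.
have [G [_ /(nearby_self hF) E ->]] := vlift_formula Uz hg => //.
rewrite E; apply: eq_bigr => i _.
by rewrite (fibre_cancel hc Uz).2 mxE.
Qed.

Lemma vertical_tangent0 z v : U (proj z) -> tangent sF z v ->
  (forall h, smooth_at sM (proj z) h -> v (h \o proj) = 0) ->
  (forall i, v (fibre_coord i) = 0) -> v = 0.
Proof.
move=> Uz tv hv v0; apply: (tangent_ext tv (tangent0 _ _)) => g hg.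
have [G [_ _ ->]] := vlift_formula Uz hg => //.
by rewrite big1 // => i _; rewrite v0 mul0r.
Qed.

End VerticalLift.

(** * The hull of a single affine space *)

Section HullAlgebra.
Context {R : realType} {V : lmodType R} (P : affineSpace V).
Implicit Types (z w : ahull P) (f g : affine_fun P).

Lemma ahullZDE (k : R) z w f : (k *: z + w) f = k * z f + w f.
Proof. by []. Qed.

Lemma ahullZE (k : R) z f : (k *: z) f = k * z f.
Proof. by []. Qed.

Lemma ahullBE z w f : (z - w) f = z f - w f.
Proof. by []. Qed.

Lemma ahull_eq z w : (forall f, z f = w f) -> z = w.
Proof. by move=> e; apply: val_inj; apply/funext. Qed.

Lemma ahull_linear z : linear (z : affine_fun P -> R^o).
Proof. by have /asboolP := valP z. Qed.

Lemma affine_funP f : is_affine f.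
Proof. by have /asboolP := valP f. Qed.

Lemma affine_fun_eq f g : (forall a, f a = g a) -> f = g.
Proof. by move=> e; apply: val_inj; apply/funext. Qed.

Lemma heightZ (k : R) (a : P) : ahull_height (k *: eval_at a) = k.
Proof. exact: mulr1. Qed.

Lemma height_eval (a : P) : ahull_height (eval_at a) = 1.
Proof. by []. Qed.

Lemma vinclE (a : P) v f : vincl a v f = f (translate a v) - f a.
Proof. by []. Qed.

Lemma vincl_linear (a : P) : linear (vincl a).
Proof.
move=> k u v; apply: ahull_eq => f; rewrite ahullZDE !vinclE.
have [l ll fl] := affine_funP f.
rewrite !fl ll /GRing.scale /=; ring.
Qed.

Lemma eval_translate (a : P) v : eval_at (translate a v) = eval_at a + vincl a v.
Proof. by rewrite /vincl addrC subrK. Qed.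

Section Coordinates.
Context {r : nat} (c : P -> 'rV[R]_r) (c' : 'rV[R]_r -> P) (l : V -> 'rV[R]_r)
  (l' : 'rV[R]_r -> V).
Hypotheses (cK : cancel c c') (c'K : cancel c' c) (lK : cancel l l') (l'K : cancel l' l)
  (ll : linear l) (cD : forall a v, c (translate a v) = c a + l v).

Lemma coord_affine i : (fun a => c a 0 i) \in @affine_pred R V P.
Proof.
apply/asboolP; exists (fun v => l v 0 i).
  by move=> k u v; rewrite ll !mxE.
by move=> a v; rewrite cD mxE.
Qed.

Definition coord_fun i : affine_fun P := AffineFun (coord_affine i).

(** An affine function is its value at the point with zero coordinates plus its
linear part, a combination of the coordinates of a vector. *)
Lemma affine_expand f : exists (k0 : R) (k : 'I_r -> R),
  f = k0 *: affine_one P + \sum_i k i *: coord_fun i.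
Proof.
have [la lla fl] := affine_funP f; pose o := c' 0.
exists (f o), (fun i => la (l' (delta_mx 0 i))).
have l'l : linear l'.
  by move=> k u v; apply: (can_inj lK); rewrite l'K ll !l'K.
apply: affine_fun_eq => a.
have -> : (f o *: affine_one P + \sum_i la (l' (delta_mx 0 i)) *: coord_fun i) a =
  f o * 1 + \sum_i la (l' (delta_mx 0 i)) * c a 0 i.
  rewrite -[LHS]/(f o * 1 + _); congr (_ + _).
  elim/big_ind2 : _ => // x1 x2 y1 y2 <- <-; by [].
have aE : a = translate o (l' (c a)).
  by apply: (can_inj cK); rewrite cD /o c'K l'K add0r.
rewrite mulr1 [in LHS]aE fl; congr (_ + _).
rewrite [in LHS](row_sum_delta (c a)).
elim/big_ind2 : _ => [|x1 x2 y1 y2 <- <-|i _].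
- by rewrite (linear_map0 l'l) (linear_map0 lla).
- by rewrite (linear_mapD l'l) (linear_mapD lla).
- by rewrite (linear_mapZ l'l) (linear_mapZ lla) mulrC.
Qed.

(** A linear form on affine functions is determined by its values on a spanning
family. *)
Lemma hull_coord_ext z w : ahull_height z = ahull_height w ->
  (forall i, z (coord_fun i) = w (coord_fun i)) -> z = w.
Proof.
move=> e0 ei; apply: ahull_eq => f; have [k0 [k ->]] := affine_expand f.
rewrite !(ahull_linear _ k0); congr (_ *: _ + _); first exact: e0.
elim/big_rec : _ => [|i x _ ex].
  by rewrite !(linear_map0 (ahull_linear _)).
by rewrite !(ahull_linear _ (k i)) ei ex.
Qed.

(** The ray through a point outside the vector part meets the affine space, and the
intersection has the expected coordinates. *)
Lemma hull_point_coord z : ahull_height z != 0 ->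
  z = ahull_height z *: eval_at (c' (\row_i (z (coord_fun i) / ahull_height z))).
Proof.
move=> z0; apply: hull_coord_ext; first by rewrite heightZ.
move=> i; rewrite ahullZE.
by rewrite /= c'K mxE mulrC divfK.
Qed.

Lemma vincl_coord (a : P) v i : vincl a v (coord_fun i) = l v 0 i.
Proof. by rewrite vinclE /= cD mxE addrAC subrr add0r. Qed.

Lemma hull_vector_coord (a : P) z : ahull_height z = 0 ->
  vincl a (l' (\row_i z (coord_fun i))) = z.
Proof.
move=> z0; apply: hull_coord_ext; first by rewrite z0 /ahull_height vinclE subrr.
by move=> i; rewrite vincl_coord l'K mxE.
Qed.

Lemma eval_inj (a b : P) : eval_at a = eval_at b -> a = b.
Proof.
move=> e; apply: (can_inj cK); apply/rowP => i.
by have := congr1 (fun z : ahull P => z (coord_fun i)) e.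
Qed.

End Coordinates.
End HullAlgebra.

(** * The hull bundle and the retraction along rays *)

Section HullBundle.
Context {R : realType} {M : Type} (sM : atlas R M)
  {V : M -> lmodType R} (sV : atlas R {m : M & V m})
  {A : forall m, affineSpace (V m)} (sA : atlas R {m : M & A m})
  (sAt : atlas R {m : M & ahull (A m)}).
Hypotheses (hM : manifold sM) (hA : affine_bundle sM sV sA)
  (hAt : canonical_hull sA sAt sM).
Local Notation Atot := {m : M & A m}.
Local Notation Ahull := {m : M & ahull (A m)}.
Local Notation iota := (@hull_embedding R M V A).
Local Notation addA := (fibre_translate A).
Local Notation addH := (vadd (fun m => ahull (A m))).

Lemma affine_manifold : manifold sA. Proof. by have [] := hA. Qed.
Lemma hull_manifold : manifold sAt. Proof. by have [[]] := hAt. Qed.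

Lemma affine_chart m0 : exists r U (c : forall m, A m -> 'rV[R]_r) c'
   (l : forall m, V m -> 'rV[R]_r) l',
  [/\ U m0, fibre_chart sM addA sA U c c' l l' & trivialization sM sV U l l'].
Proof.
have [_ _ [r /(_ m0)[U [c [c' [l [l' [Um tA tV ll cD]]]]]]]] := hA.
exists r, U, c, c', l, l'; split=> //; split=> // m Um'.
by have [_ + _ _] := tV; apply.
Qed.

Lemma hull_chart m0 : exists r U (c : forall m, ahull (A m) -> 'rV[R]_r) c',
  U m0 /\ fibre_chart sM addH sAt U c c' c c'.
Proof.
have [[_ [r /(_ m0)[U [c [c' [Um tA cl]]]]]] _ _] := hAt.
exists r, U, c, c'; split=> //; split=> // m Um'.
  by have [_ + _ _] := tA; apply.
by move=> a v; exact: (linear_mapD (cl _ Um')).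
Qed.

Lemma affine_proj_smooth a : smooth_map_at sA sM a (@projT1 M (fun m => A m)).
Proof.
have [r [U [c [c' [l [l' [Um hc _]]]]]]] := affine_chart (projT1 a).
exact: (proj_smooth hc Um).
Qed.

Lemma hull_proj_smooth z : smooth_map_at sAt sM z (@projT1 M (fun m => ahull (A m))).
Proof.
have [r [U [c [c' [Um hc]]]]] := hull_chart (projT1 z).
exact: (proj_smooth hc Um).
Qed.

Lemma embedding_smooth a : smooth_map_at sA sAt a iota.
Proof. by move=> g; apply: (hull_embedding_smooth hAt). Qed.

Definition height (z : Ahull) : R := ahull_height (projT2 z).

Lemma height_smooth z : smooth_at sAt z height.
Proof.
apply: (hull_pairing_smooth hAt (g := fun m => affine_one (A m)) (mopenT hM)) => // a _.
exact: (smooth_at_cst affine_manifold a 1).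
Qed.

Section Coordinates.
Context {r : nat} {U : set M} {c : forall m, A m -> 'rV[R]_r}
  {c' : forall m, 'rV[R]_r -> A m} {l : forall m, V m -> 'rV[R]_r}
  {l' : forall m, 'rV[R]_r -> V m}.
Hypothesis hc : fibre_chart sM addA sA U c c' l l'.

Let cK m (Um : U m) : cancel (@c m) (@c' m).
Proof. by have [_ + _ _] := fibre_triv hc => /(_ m Um)[]. Qed.
Let c'K m (Um : U m) : cancel (@c' m) (@c m).
Proof. by have [_ + _ _] := fibre_triv hc => /(_ m Um)[]. Qed.

(** The pairing of the hull with affine functions is smooth along families of
affine functions indexed by the whole base; outside the domain of the chart the
coordinate is extended by zero. *)
Definition coord_section (i : 'I_r) (m : M) : affine_fun (A m) :=
  match pselect (U m) with
  | left Um => coord_fun (fibre_linear hc Um) (fibre_add hc Um) i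
  | right _ => 0
  end.

Lemma coord_sectionE i m (Um : U m) :
  coord_section i m = coord_fun (fibre_linear hc Um) (fibre_add hc Um) i.
Proof.
rewrite /coord_section; case: pselect => // Um'; exact: affine_fun_eq.
Qed.

Definition hull_coord (i : 'I_r) (z : Ahull) : R := projT2 z (coord_section i (projT1 z)).

Lemma hull_coord_smooth i z : U (projT1 z) -> smooth_at sAt z (hull_coord i).
Proof.
move=> Uz; have [oU _ _ _] := fibre_triv hc.
apply: (hull_pairing_smooth hAt (g := coord_section i) oU) => // a Ua.
apply: (smooth_at_eq affine_manifold) (fibre_coord_smooth hM hc i Ua).
apply: nearbyS (nearby_fibre hM affine_manifold hc Ua) => q Uq.
by rewrite (coord_sectionE i Uq).
Qed.

Lemma hull_coord_ray_point z : U (projT1 z) -> height z != 0 ->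
  projT2 z = height z *: eval_at (c' (projT1 z) (\row_i (hull_coord i z / height z))).
Proof.
move=> Uz z0.
rewrite [LHS](hull_point_coord (cK Uz) (c'K Uz) (fibre_cancel hc Uz).1
  (fibre_cancel hc Uz).2 (fibre_linear hc Uz) (fibre_add hc Uz) z0).
congr (_ *: eval_at (c' _ _)); apply/rowP => i; rewrite !mxE /hull_coord.
by rewrite (coord_sectionE i Uz).
Qed.

Lemma hull_coord_vincl (a : Atot) (v : V (projT1 a)) i : U (projT1 a) ->
  vincl (projT2 a) v (coord_section i (projT1 a)) = l v 0 i.
Proof. by move=> Ua; rewrite (coord_sectionE i Ua) vincl_coord. Qed.

End Coordinates.

Lemma eval_at_inj m (x y : A m) : eval_at x = eval_at y -> x = y.
Proof.
have [r [U [c [c' [l [l' [Um hc _]]]]]]] := affine_chart m.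
have [_ cc' _ _] := fibre_triv hc.
exact: (eval_inj (cc' m Um).1 (fibre_linear hc Um) (fibre_add hc Um)).
Qed.

(** The implication stays inside the existential, so that the chosen point is
defined for every [z]; affine fibres are nonempty, being modelled on
coordinate spaces. *)
Lemma ray_point_ex (z : Ahull) : exists a : A (projT1 z), height z != 0 ->
  projT2 z = height z *: eval_at a.
Proof.
have [r [U [c [c' [l [l' [Um hc _]]]]]]] := affine_chart (projT1 z).
by exists (c' (projT1 z) (\row_i (hull_coord hc i z / height z))) =>
  /(hull_coord_ray_point hc Um).
Qed.

Definition ray_point (z : Ahull) : A (projT1 z) := projT1 (cid (ray_point_ex z)).

Lemma ray_pointP z : height z != 0 -> projT2 z = height z *: eval_at (ray_point z).
Proof. exact: (projT2 (cid (ray_point_ex z))). Qed.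

Lemma ray_point_unique z (x : A (projT1 z)) (k : R) : k != 0 -> projT2 z =
  k *: eval_at x ->
  ray_point z = x.
Proof.
move=> k0 zk; have hz : height z = k by rewrite /height zk heightZ.
apply: eval_at_inj; apply: (scalerI k0); rewrite -zk -hz -ray_pointP // hz //.
Qed.

(** The first component is literally that of [z]: a section of a bundle over the
affine bundle, composed with the retraction, is then a section over the hull
without any transport. *)
Definition ray_retraction (z : Ahull) : Atot := existT (fun m => apoint (A m))
  (projT1 z) (ray_point z).

Lemma ray_retraction_scaled (k : R) a : k != 0 -> ray_retraction
  (scaled_embedding k a) = a.
Proof.
case: a => m x k0; rewrite /ray_retraction /scaled_embedding /=; congr existT.
exact: (@ray_point_unique (existT _ m (k *: eval_at x)) x k).
Qed.

Lemma scaled_embedding1 : scaled_embedding 1 = iota.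
Proof. by apply/funext => -[m x]; rewrite /scaled_embedding scale1r. Qed.

Lemma ray_retraction_embedding a : ray_retraction (iota a) = a.
Proof. by rewrite -scaled_embedding1 ray_retraction_scaled // oner_neq0. Qed.

(** Sections pulled back by the retraction restrict to the original ones. This is
not an instance of the previous equality, because the type of [f] depends on
the point. *)
Lemma ray_retraction_section (f : forall a : Atot, ahull (A (projT1 a))) a :
  f (ray_retraction (iota a)) = f a.
Proof.
case: a => m x.
have E : ray_point (iota (existT _ m x)) = x.
  by apply: (@ray_point_unique (iota (existT _ m x)) x 1);
    [exact: oner_neq0|rewrite scale1r].
by rewrite /ray_retraction E.
Qed.

(** In affine coordinates the retraction divides the linear coordinates by the
height. *)
Lemma ray_retraction_smooth z : hull_complement A z ->
  smooth_map_at sAt sA z ray_retraction.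
Proof.
rewrite /hull_complement /= => z0 g hg.
have [r [U [c [c' [l [l' [Uz hc _]]]]]]] := affine_chart (projT1 z).
have [oU cc' _ st] := fibre_triv hc.
pose Psi z' : 'rV[R]_r := \row_i (hull_coord hc i z' / height z').
have sPsi i : smooth_at sAt z (fun q => Psi q 0 i).
  apply: (smooth_at_eq hull_manifold)
    (smooth_atM hull_manifold (hull_coord_smooth hc i Uz)
     (smooth_atV hull_manifold (height_smooth z) z0)).
  by apply: nearbyT => [|q]; [exact: hull_manifold|rewrite mxE].
have E q : U (projT1 q) -> height q != 0 -> ray_retraction q = existT
  (fun m => apoint (A m)) (projT1 q) (c' _ (Psi q)).
  move=> Uq q0; rewrite /ray_retraction; congr existT; apply: (ray_point_unique q0).
  exact: hull_coord_ray_point.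
rewrite E // in hg.
have hg' := st (projT1 z, Psi z) Uz _ hg.
have sg := smooth_at_prod hM hull_manifold (hull_proj_smooth (z := z)) sPsi hg'.
apply: (smooth_at_eq hull_manifold _ sg).
have := nearbyI hull_manifold
  (nearby_continuous hull_manifold (height_smooth z) (@open_neq R 0) z0)
  (smooth_map_nearby hull_manifold hM (hull_proj_smooth (z := z))
    (nearby_mopen hM oU Uz)).
by apply: nearbyS => q [q0 Uq] /=; rewrite E.
Qed.

(** The embedding is affine on fibres, so it maps vertical lines to vertical
lines. *)
Lemma pushforward_vlift a (b : V (projT1 a)) :
  pushforward sAt iota a (vlift addA sA b) =
  vlift addH sAt (a := iota a) (vincl (projT2 a) b).
Proof.
apply/funext => g; rewrite /pushforward /vlift /on_germs.
case: asboolP => // hg; rewrite asboolT; last exact: embedding_smooth.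
congr (derive1 _ 0); apply/funext => s.
rewrite /iota /= /fibre_translate eval_translate /vadd.
by rewrite (linear_mapZ (vincl_linear _)).
Qed.

End HullBundle.

(** * The linearization in terms of fields on the affine bundle *)

Lemma section_of_coords (R : realType) (M N : Type) (sM : atlas R M) (sN : atlas R N)
    (F : M -> Type) (sF : atlas R {m : M & F m}) r U (c : forall m, F m -> 'rV[R]_r) c'
    (pi : N -> M) (f : forall q, F (pi q)) p :
  manifold sM -> manifold sN -> trivialization sM sF U c c' -> U (pi p) ->
  smooth_map_at sN sM p pi -> (forall i, smooth_at sN p (fun q => c (pi q) (f q) 0 i)) ->
  smooth_map_at sN sF p (fun q => existT F (pi q) (f q)).
Proof.
move=> hM hN [oU cc' _ st] Up spi sf g hg.
have hg' : smooth_at sF (existT F (pi p) (c' _ (c _ (f p)))) g by rewrite (cc' _ Up).1.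
have := smooth_at_prod hM hN spi sf (st (pi p, c _ (f p)) Up _ hg').
apply: (smooth_at_eq hN).
apply: nearbyS (smooth_map_nearby hN hM spi (nearby_mopen hM oU Up)) => q Uq.
by rewrite /= (cc' _ Uq).1.
Qed.

Section AffineLinearization.
Context {R : realType} {M : Type} (sM : atlas R M)
  {V : M -> lmodType R} (sV : atlas R {m : M & V m})
  {A : forall m, affineSpace (V m)} (sA : atlas R {m : M & A m})
  (sAt : atlas R {m : M & ahull (A m)}).
Hypotheses (hM : manifold sM) (hA : affine_bundle sM sV sA)
  (hAt : canonical_hull sA sAt sM).
Local Notation Atot := {m : M & A m}.
Local Notation Ahull := {m : M & ahull (A m)}.
Local Notation iota := (@hull_embedding R M V A).
Local Notation addA := (fibre_translate A).
Local Notation addH := (vadd (fun m => ahull (A m))).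
Local Notation projA := (@projT1 M (fun m => A m)).
Local Notation projHull := (@projT1 M (fun m => ahull (A m))).
Local Notation hull0 := (hull_complement A).
Local Notation rho := (ray_retraction hA).
Let hmA : manifold sA := affine_manifold hA.
Let hmH : manifold sAt := hull_manifold hAt.

Variables (xiH : Atot -> tvector R M -> tvector R Atot)
  (kappa : forall a : Atot, tvector R Atot -> V (projT1 a)).
Hypotheses (hxi : connection sM sA setT xiH)
  (hkappa : connector sM addA sA setT xiH kappa).
Variables (xit : Ahull -> tvector R M -> tvector R Ahull)
  (kappat : forall z : Ahull, tvector R Ahull -> ahull (A (projT1 z))).
Hypotheses (hext : homogeneous_extension sAt sM xiH xit)
  (hxit : connection sM sAt hull0 xit)
  (hkappat : connector sM addH sAt hull0 xit kappat).

Lemma vliftA_tangent (a : Atot) (b : V (projT1 a)) : tangent sA a (vlift addA sA b).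
Proof.
have [r [U [c [c' [l [l' [Ua hc _]]]]]]] := affine_chart hA (projT1 a).
exact: (vlift_tangent hM hmA hc b Ua).
Qed.

Lemma vliftH_tangent (z : Ahull) (b : ahull (A (projT1 z))) :
  tangent sAt z (vlift addH sAt b).
Proof.
have [r [U [c [c' [Uz hc]]]]] := hull_chart hAt (projT1 z).
exact: (vlift_tangent hM hmH hc b Uz).
Qed.

Definition base_part (a : Atot) (w : tvector R Atot) : tvector R M :=
  pushforward sM projA a w.

Lemma base_part_tangent a w : tangent sA a w -> tangent sM (projA a) (base_part a w).
Proof. by apply: pushforward_tangent => // g hg; exact: (affine_proj_smooth hA hg). Qed.

(** The difference of [w] and of the horizontal lift of its projection is killed
by the projection, hence it is a vertical lift; the connector recognizes which
one. *)
Lemma tangent_decomp a w : tangent sA a w ->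
  w = xiH a (base_part a w) + vlift addA sA (kappa a w).
Proof.
move=> tw; have tp := base_part_tangent tw.
have txi := connection_tangent hxi I tp.
have [r [U [c [c' [l [l' [Ua hc _]]]]]]] := affine_chart hA (projT1 a).
have tv : tangent sA a (w - xiH a (base_part a w)) by exact: tangentB.
have E := vertical_tangent hM hmA hc Ua tv.
set b := l' _ _ in E.
have {}E : w - xiH a (base_part a w) = vlift addA sA b.
  apply: E => h hh; rewrite !fctE; apply/eqP; rewrite subr_eq0; apply/eqP.
  have e1 := pushforwardE (F := projA) w hh.
  have := pushforwardE (F := projA) (xiH a (base_part a w)) hh.
  by rewrite (connection_lift hxi I tp) /base_part e1.
have wE : w = 1 *: xiH a (base_part a w) + vlift addA sA b.
  by rewrite scale1r -E addrC subrK.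
rewrite [in X in _ + vlift _ _ X]wE (connector_linear hkappa) //;
  last exact: vliftA_tangent.
rewrite (connector_hor hkappa) // (connector_vert hkappa) // scaler0 add0r.
by rewrite -E addrC subrK.
Qed.

Lemma embedding_hull0 a : hull0 (iota a).
Proof. exact: oner_neq0. Qed.

Lemma homogeneous_embedding a v : tangent sM (projA a) v -> xit (iota a) v =
  pushforward sAt iota a (xiH a v).
Proof. by move=> tv; have := hext (oner_neq0 R) tv; rewrite scaled_embedding1. Qed.

Lemma pushforward_embedding_tangent a w : tangent sA a w -> tangent sAt (iota a)
  (pushforward sAt iota a w).
Proof. by apply: pushforward_tangent => // g hg; exact: (embedding_smooth hAt hg). Qed.

(** The embedding maps horizontal lifts to horizontal lifts, by homogeneity, and
vertical lifts to vertical lifts; by the decomposition this is enough to compare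
the connectors on every tangent vector. *)
Lemma connector_embedding a w : tangent sA a w ->
  kappat (iota a) (pushforward sAt iota a w) = vincl (projT2 a) (kappa a w).
Proof.
move=> tw; have tp := base_part_tangent tw.
rewrite [in LHS](tangent_decomp tw) -[xiH a _]scale1r pushforwardZD -homogeneous_embedding //.
rewrite (pushforward_vlift hAt) (connector_linear hkappat) //; first last.
- exact: vliftH_tangent.
- exact: (connection_tangent hxit (embedding_hull0 a) tp).
- exact: embedding_hull0.
rewrite (connector_hor hkappat (embedding_hull0 a) tp)
  (connector_vert hkappat _ (embedding_hull0 a)).
by rewrite scaler0 add0r.
Qed.

Section Fixed.
Variables (U : Atot -> tvector R Atot) (hU : vfield sA setT U)
  (s : forall a : Atot, ahull (A (projT1 a))) (hs : smooth_section sA sAt setT s).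

Let hor a := xiH a (base_part a (U a)).

Let tU a : tangent sA a (U a). Proof. by have [] := hU (p := a) I. Qed.

Lemma projH_horizontal_lift : projH addA sA kappa U = hor.
Proof.
apply/funext => a; rewrite /projH /projV; apply/eqP; rewrite subr_eq; apply/eqP.
exact: tangent_decomp (tU a).
Qed.

Lemma horizontal_lift_field : vfield sA setT hor.
Proof.
apply: (connection_smooth hxi (Y := fun a => base_part a (U a))) => //.
  exact: mopenT hmA.
move=> a _; split; first exact: base_part_tangent.
move=> g hg.
apply: (smooth_at_eq hmA) ((hU (p := a) I).2 _ (affine_proj_smooth hA hg)).
apply: nearbyS (smooth_map_nearby hmA hM (affine_proj_smooth hA (a := a))
  (smooth_at_nearby hM hg)).
by move=> q gq; rewrite /base_part pushforwardE.
Qed.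

Let thU a : tangent sA a (hor a). Proof. by have [] := horizontal_lift_field
  (p := a) I. Qed.

Lemma vlift_kappaU a : vlift addA sA (kappa a (U a)) = U a - hor a.
Proof.
by apply/esym/eqP; rewrite subr_eq addrC; apply/eqP; exact: tangent_decomp (tU a).
Qed.

(* Only the value of [X] on the affine bundle is prescribed; this extension has
   the same projection to the base all along a ray. *)
Let Y (z : Ahull) := base_part (rho z) (U (rho z)).
Let X z := xit z (Y z).

Lemma base_field : vfield_along sAt sM projHull hull0 Y.
Proof.
move=> z z0; split; first exact: (base_part_tangent (tU (rho z))).
move=> g hg.
have hg' : smooth_at sA (rho z) (fun a => U a (g \o projA)).
  exact: (hU (p := rho z) I).2 _ (affine_proj_smooth hA (a := rho z) hg).
apply: (smooth_at_eq hmH) (ray_retraction_smooth hM hAt z0 hg').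
apply: nearbyS (smooth_map_nearby hmH hM (hull_proj_smooth hAt (z := z))
  (smooth_at_nearby hM hg)).
by move=> q gq; rewrite /Y /base_part pushforwardE.
Qed.

Lemma hull0_open : mopen sAt hull0.
Proof. exact: connection_open hxit. Qed.

Lemma extension_field : vfield sAt hull0 X.
Proof. exact: (connection_smooth hxit hull0_open _ base_field). Qed.

Lemma extension_smooth_field z : hull0 z -> smooth_field_at sAt z X.
Proof. by move=> z0; exact: (vfield_smooth_at hmH hull0_open z0 extension_field). Qed.

Lemma extension_embedding a : X (iota a) = pushforward sAt iota a (hor a).
Proof.
rewrite -homogeneous_embedding; last exact: base_part_tangent.
by rewrite /X /Y ray_retraction_embedding.
Qed.

Lemma pullback_vlift_smooth (f : forall a : Atot, ahull (A (projT1 a))) z : hull0 z ->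
  smooth_section sA sAt setT f -> smooth_field_at sAt z
    (section_vlift addH sAt (fun q => f (rho q))).
Proof.
move=> z0 hf.
have [r [W [c [c' [Wz hc]]]]] := hull_chart hAt (projT1 z).
apply: (section_vlift_smooth hM hmH hc Wz) => i.
have := @fibre_coord_smooth _ _ _ _ _ _ _ hM _ _ _ _ _ _ hc i
  (existT _ (projT1 z) (f (rho z))) Wz.
by move/(hf (rho z) I); exact: (ray_retraction_smooth hM hAt z0).
Qed.

(** A connector is not assumed to be smooth. The fibre coordinates of its value on
[U] are the derivatives of the coordinate functions along the vertical part of
[U], which is a smooth field as the difference of [U] and its horizontal part. *)
Lemma vincl_kappa_smooth : smooth_section sA sAt setT
  (fun a => vincl (projT2 a) (kappa a (U a))).
Proof.
move=> a _.
have [r [W [c [c' [Wa hc]]]]] := hull_chart hAt (projT1 a).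
have [oW _ _ _] := fibre_triv hc.
apply: (section_of_coords hM hmA (fibre_triv hc) Wa
  (affine_proj_smooth hA (a := a))) => i.
have si := embedding_smooth hAt (fibre_coord_smooth hM hc i (z := iota a) Wa).
have hd := smooth_atB hmA ((hU (p := a) I).2 _ si)
  ((horizontal_lift_field (p := a) I).2 _ si).
apply: (smooth_at_eq hmA) hd.
have nW := smooth_map_nearby hmA hM (affine_proj_smooth hA (a := a))
  (nearby_mopen hM oW Wa).
apply: nearbyS nW => q Wq.
rewrite -(vlift_fibre_coord hM hc (z := iota q)) // -(pushforward_vlift hAt).
rewrite pushforwardE; last exact: (fibre_coord_smooth hM hc i (z := iota q) Wq).
by rewrite vlift_kappaU.
Qed.

Let shat (a : Atot) : Ahull := existT (fun m => ahull (A m)) (projT1 a) (s a).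
Let e0s a := ahull_height (s a).

Lemma e0s_smooth a : smooth_at sA a e0s.
Proof. by have := hs (p := a) I (height_smooth hM hA hAt (shat a)). Qed.

Lemma vector_part_ex (a : Atot) : exists v : V (projT1 a), vincl (projT2 a) v =
  s a - e0s a *: eval_at (projT2 a).
Proof.
have [r [W [c [c' [l [l' [Wa hc tV]]]]]]] := affine_chart hA (projT1 a).
have [_ cc' _ _] := fibre_triv hc.
exists (l' _ (\row_i (s a - e0s a *: eval_at (projT2 a))
  (coord_fun (fibre_linear hc Wa) (fibre_add hc Wa) i))).
apply: (hull_vector_coord (cc' _ Wa).1 (cc' _ Wa).2 (fibre_cancel hc Wa).1
  (fibre_cancel hc Wa).2).
rewrite /ahull_height ahullBE ahullZE /= mulr1 subrr //.
Qed.

Definition vector_part (a : Atot) : V (projT1 a) := projT1 (cid (vector_part_ex a)).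
Local Notation sbar := vector_part.

Lemma vector_partP (a : Atot) : vincl (projT2 a) (sbar a) = s a - e0s a *: eval_at
  (projT2 a).
Proof. exact: (projT2 (cid (vector_part_ex a))). Qed.

Lemma vector_part_coord_smooth r W (c : forall m, A m -> 'rV[R]_r) c'
  (l : forall m, V m -> 'rV[R]_r) l' a i
  (hc : fibre_chart sM addA sA W c c' l l') :
  W (projT1 a) -> smooth_at sA a (fun q => l (projT1 q) (sbar q) 0 i).
Proof.
move=> Wa.
have h1 := hs (p := a) I (hull_coord_smooth hM hA hAt hc i (z := shat a) Wa).
have h2 := fibre_coord_smooth hM hc i Wa.
apply: (smooth_at_eq hmA) (smooth_atB hmA h1 (smooth_atM hmA (e0s_smooth a) h2)).
apply: nearbyS (nearby_fibre hM hmA hc Wa) => q Wq.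
rewrite -(hull_coord_vincl hc _ i Wq) vector_partP ahullBE ahullZE /hull_coord /=.
by rewrite (coord_sectionE hc i Wq).
Qed.

Lemma vector_part_smooth : smooth_section sA sV setT sbar.
Proof.
move=> a _.
have [r [W [c [c' [l [l' [Wa hc tV]]]]]]] := affine_chart hA (projT1 a).
apply: (section_of_coords hM hmA tV Wa (affine_proj_smooth hA (a := a))) => i.
exact: vector_part_coord_smooth hc Wa.
Qed.

Lemma vector_part_vlift_smooth a : smooth_field_at sA a (section_vlift addA sA sbar).
Proof.
have [r [W [c [c' [l [l' [Wa hc tV]]]]]]] := affine_chart hA (projT1 a).
apply: (section_vlift_smooth hM hmA hc Wa) => i.
exact: vector_part_coord_smooth hc Wa.
Qed.

Lemma vincl_vector_part_smooth : smooth_section sA sAt setT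
  (fun a => vincl (projT2 a) (sbar a)).
Proof.
move=> a _.
have [r [W [c [c' [Wa hc]]]]] := hull_chart hAt (projT1 a).
have [oW _ _ _] := fibre_triv hc.
apply: (section_of_coords hM hmA (fibre_triv hc) Wa
  (affine_proj_smooth hA (a := a))) => i.
have h1 := hs (p := a) I (fibre_coord_smooth hM hc i (z := shat a) Wa).
have h2 := embedding_smooth hAt (fibre_coord_smooth hM hc i (z := iota a) Wa).
apply: (smooth_at_eq hmA) (smooth_atB hmA h1 (smooth_atM hmA (e0s_smooth a) h2)).
have nW := smooth_map_nearby hmA hM (affine_proj_smooth hA (a := a))
  (nearby_mopen hM oW Wa).
apply: nearbyS nW => q Wq.
rewrite vector_partP /fibre_coord /= -scaleN1r (linear_mapD (fibre_linear hc Wq)).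
by rewrite !(linear_mapZ (fibre_linear hc Wq)) !mxE mulN1r.
Qed.

Let Euler := section_vlift addH sAt (fun z => projT2 z).

Lemma Euler_smooth z : smooth_field_at sAt z Euler.
Proof.
have [r [W [c [c' [Wz hc]]]]] := hull_chart hAt (projT1 z).
apply: (section_vlift_smooth hM hmH hc Wz) => i.
exact: (fibre_coord_smooth hM hc i Wz).
Qed.

Lemma hull_ray (a : Atot) (x : R) :
  existT (fun m => ahull (A m)) (projT1 a)
    (addH (projT1 a) (eval_at (projT2 a)) (x *: eval_at (projT2 a))) =
  scaled_embedding (1 + x) a.
Proof. by rewrite /scaled_embedding /vadd scalerDl scale1r. Qed.

Lemma near_ray_neq0 : \forall x \near (0 : R), 1 + x != 0.
Proof.
have := @nbhs0_lt R R 1 ltr01; apply: filterS => x x1.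
apply: contraTneq x1 => /eqP; rewrite addrC addr_eq0 => /eqP ->.
by rewrite normrN1 ltxx.
Qed.

Lemma Euler_radial a f d : smooth_at sAt (iota a) f ->
  is_derive (0 : R) 1 (fun x => f (scaled_embedding (1 + x) a)) d -> Euler (iota a) f = d.
Proof.
move=> hf hd.
have [r [W [c [c' [Wz hc]]]]] := hull_chart hAt (projT1 a).
apply: (vliftE hf); rewrite
  (_ : (fun _ => _) = fun x => f (scaled_embedding (1 + x) a)) //.
by apply/funext => x; rewrite -hull_ray.
Qed.

Lemma extension_proj z h : hull0 z -> smooth_at sM (projT1 z) h ->
  X z (h \o projHull) = U (rho z) (h \o projA).
Proof.
move=> z0 hh; have [tY _] := base_field z0.
have := pushforwardE (F := projHull) (p := z) (X z) hh.
rewrite (connection_lift hxit z0 tY) => <-.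
by rewrite /Y /base_part pushforwardE.
Qed.

Lemma extension_scaled (k : R) a : k != 0 ->
  X (scaled_embedding k a) = pushforward sAt (scaled_embedding k) a (hor a).
Proof.
move=> k0; rewrite /X /Y ray_retraction_scaled //; apply: hext => //.
exact: base_part_tangent.
Qed.

(** The bracket is a tangent vector, so it is enough to test it on functions of the
base and on linear fibre coordinates. On the former the Euler field vanishes and
[X] gives a function that is constant on rays. On the latter the Euler field is
the identity and [X] gives a function of degree one on the ray through [a],
because the extended connection is homogeneous. *)
Lemma bracket_extension_Euler a : bracket sAt X Euler (iota a) = 0.
Proof.
have [r [W [c [c' [Wa hc]]]]] := hull_chart hAt (projT1 a).
have Xa := extension_smooth_field (embedding_hull0 a); have tX :=
  smooth_field_tangent hmH Xa.
have Da := Euler_smooth (iota a); have tD := smooth_field_tangent hmH Da.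
have [oW _ _ _] := fibre_triv hc.
apply: (vertical_tangent0 hM hmH hc (z := iota a) Wa (bracket_tangent hmH Xa Da)) =>
  [h hh|i].
  (* functions of the base *)
  have hp := hull_proj_smooth hAt hh (z := iota a).
  rewrite (bracketE _ _ hp).
  have -> : (fun q => Euler q (h \o projHull)) = fun=> 0.
    by apply/funext => q; exact: vlift_proj.
  rewrite (tangent_cst hmH _ tX) sub0r.
  rewrite (tangent_eq hmH (g := fun q => U (rho q) (h \o projA)) tD); last first.
    have nh := smooth_map_nearby hmH hM (hull_proj_smooth hAt (z := iota a))
      (smooth_at_nearby hM hh).
    have := nearbyI hmH (nearby_mopen hmH hull0_open (embedding_hull0 a)) nh.
    by apply: nearbyS => q [q0 hq]; exact: extension_proj.
  have sU : smooth_at sA (rho (iota a)) (fun a' => U a' (h \o projA)).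
    by rewrite ray_retraction_embedding; exact: (hU (p := a) I).2 _
      (affine_proj_smooth hA hh (a := a)).
  have -> : Euler (iota a) (fun q => U (rho q) (h \o projA)) = 0; last exact: oppr0.
  apply: Euler_radial.
    exact: (ray_retraction_smooth hM hAt (embedding_hull0 a) sU).
  have := is_derive_cst (U a (h \o projA)) (0 : R) 1.
  apply: near_eq_is_derive; apply: filterS near_ray_neq0 => x x0.
  by rewrite ray_retraction_scaled.
(* linear fibre coordinates *)
have sg : smooth_at sAt (iota a) (fibre_coord c i) := fibre_coord_smooth hM hc i
  (z := iota a) Wa.
rewrite (bracketE _ _ sg).
rewrite (tangent_eq hmH (g := fibre_coord c i) tX); last first.
  apply: nearbyS (nearby_fibre hM hmH hc (z := iota a) Wa) => q Wq.
  exact: (vlift_fibre_coord hM hc _ i Wq).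
suff -> : Euler (iota a) (fun q => X q (fibre_coord c i)) = X (iota a) (fibre_coord c i).
  exact: subrr.
apply: Euler_radial; first exact: Xa.2.
have E (k : R) : k != 0 -> X (scaled_embedding k a) (fibre_coord c i) = k * X (iota a)
  (fibre_coord c i).
  move=> k0; rewrite extension_embedding extension_scaled // !pushforwardE //; last first.
    exact: (fibre_coord_smooth hM hc i (z := scaled_embedding k a) Wa).
  have si := embedding_smooth hAt (a := a) sg.
  rewrite -(tangentfZ hmA k (thU a) si); apply: (tangent_eq hmA (thU a)).
  apply: nearbyS (smooth_map_nearby hmA hM (affine_proj_smooth hA (a := a))
    (nearby_mopen hM oW Wa)) => q Wq.
  by rewrite /= /fibre_coord /= (linear_mapZ (fibre_linear hc Wq)) mxE.
pose x0 := X (iota a) (fibre_coord c i).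
have [did _] := is_diff_id (x0 : R).
have := is_derive_line0 (x0 : R) did; rewrite derive_id.
apply: near_eq_is_derive; apply: filterS near_ray_neq0 => x x1.
by rewrite E // mulrDl mul1r.
Qed.

Let vertU (a : Atot) := vincl (projT2 a) (kappa a (U a)).
Let Xv := section_vlift addH sAt (fun q => vertU (rho q)).
Let W z := X z + Xv z.

Lemma total_field : vfield sAt hull0 W.
Proof.
move=> z z0; have sX := extension_smooth_field z0.
have svt := pullback_vlift_smooth z0 vincl_kappa_smooth.
split; first exact: (tangentD (smooth_field_tangent hmH sX)
  (smooth_field_tangent hmH svt)).
by move=> g hg; exact: (smooth_atD hmH (sX.2 _ hg) (svt.2 _ hg)).
Qed.

Let t z := s (rho z).

Lemma pullback_smooth : smooth_section (pi := projHull) sAt sAt hull0 t.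
Proof. by move=> z z0 g hg; exact:
  (ray_retraction_smooth hM hAt z0 (hs (p := rho z) I hg)). Qed.

Lemma pullback_embedding a : t (iota a) = s a.
Proof. exact: ray_retraction_section. Qed.

Lemma vertical_extension_embedding a : Xv (iota a) = pushforward sAt iota a
  (vlift addA sA (kappa a (U a))).
Proof.
rewrite (pushforward_vlift hAt) /Xv /section_vlift; congr vlift.
exact: (ray_retraction_section hA vertU).
Qed.

(** The decomposition of [U a] into its horizontal and vertical parts, transported
by the embedding. *)
Lemma total_field_embedding a : W (iota a) = pushforward sAt iota a (U a).
Proof.
rewrite /W vertical_extension_embedding extension_embedding -[pushforward sAt iota a
  (hor a)]scale1r -pushforwardZD scale1r.
by congr pushforward; rewrite -tangent_decomp.
Qed.

Lemma connector_total_field z : hull0 z -> kappat z (W z) = vertU (rho z).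
Proof.
move=> z0; have tX := smooth_field_tangent hmH (extension_smooth_field z0).
rewrite /W -[X z]scale1r (connector_linear hkappat) //; last exact: vliftH_tangent.
have [tY _] := base_field z0.
by rewrite (connector_hor hkappat z0 tY) scaler0 add0r (connector_vert hkappat _ z0).
Qed.

Lemma projH_total_field z : hull0 z -> projH addH sAt kappat W z = X z.
Proof. by move=> z0; rewrite /projH /projV connector_total_field // /W addrK. Qed.

Let h (z : Ahull) := e0s (rho z) / height z.
Let tbar z := vincl (projT2 (rho z)) (sbar (rho z)).

Lemma height_quot_smooth z : hull0 z -> smooth_at sAt z h.
Proof.
move=> z0; apply: (smooth_atM hmH); first exact:
  (ray_retraction_smooth hM hAt z0 (e0s_smooth _)).
exact: (smooth_atV hmH (height_smooth hM hA hAt z)).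
Qed.

Lemma height_quot_embedding a : h (iota a) = e0s a.
Proof. by rewrite /h ray_retraction_embedding /height height_eval divr1. Qed.

(** The pullback [t] is homogeneous of degree zero whereas the tautological section
has degree one, which accounts for the height in the denominator of [h]. *)
Lemma pullback_vlift_decomp z : hull0 z -> section_vlift addH sAt t z =
  section_vlift addH sAt tbar z + h z *: Euler z.
Proof.
move=> z0.
have [r [W' [c [c' [Wz hc]]]]] := hull_chart hAt (projT1 z).
rewrite /Euler /section_vlift addrC -(vlift_linear hM hmH hc) //; congr vlift.
rewrite [in RHS](ray_pointP hA z0) scalerA /h divfK // /tbar vector_partP addrC subrK //.
Qed.

(** The Leibniz rule for the decomposition of [t]: the bracket with the vector part
is related to a bracket on the affine bundle, and the bracket with the Euler
field vanishes. *)
Lemma horizontal_part a :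
  kappat (iota a) (bracket sAt (projH addH sAt kappat W) (section_vlift addH sAt t)
    (iota a)) =
  vincl (projT2 a) (kappa a (bracket sA hor (section_vlift addA sA sbar) a)) +
  hor a e0s *: eval_at (projT2 a).
Proof.
have z0 := embedding_hull0 a; have n0 := nearby_mopen hmH hull0_open z0.
have sX := extension_smooth_field z0; have tX := smooth_field_tangent hmH sX.
have st := pullback_vlift_smooth z0 hs.
have stbar := pullback_vlift_smooth z0 vincl_vector_part_smooth.
rewrite -(bracket_eq hmH sX st); first last.
- exact: (nearbyT hmH).
- by apply: nearbyS n0 => q q0; rewrite projH_total_field.
rewrite (bracket_leibniz hmH sX stbar (Euler_smooth _) (height_quot_smooth z0));
  last first.
  by apply: nearbyS n0 => q; exact: pullback_vlift_decomp.
rewrite bracket_extension_Euler scaler0 addr0 addrC.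
have sHU : smooth_field_at sA a hor.
  apply: (vfield_smooth_at hmA (W := setT)) horizontal_lift_field => //.
  exact: mopenT hmA.
rewrite (bracket_related hmA hmH (embedding_smooth hAt (a := a)) sHU
  (vector_part_vlift_smooth a) sX stbar); first last.
- apply: (nearbyT hmA) => q; rewrite (pushforward_vlift hAt) /section_vlift; congr vlift.
  exact: (ray_retraction_section hA (fun a => vincl (projT2 a) (sbar a))).
- apply: (nearbyT hmA) => q; exact: extension_embedding.
have tB := bracket_tangent hmA sHU (vector_part_vlift_smooth a).
rewrite (connector_linear hkappat) //;
  [|exact: vliftH_tangent|exact: pushforward_embedding_tangent].
rewrite connector_embedding // (connector_vert hkappat _ z0) addrC; congr (_ + _ *: _).
rewrite extension_embedding pushforwardE; last exact: height_quot_smooth.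
by congr (hor a _); apply/funext => q; exact: height_quot_embedding.
Qed.

(** The field is vertical, so only the values of [t] on the fibre of the affine
bundle through [a] matter, where [t] is [s]. *)
Lemma vertical_part a :
  fibre_derivative (pi := projHull) sAt t (projV addH sAt kappat W) (iota a) =
  fibre_derivative (pi := projA) (E := fun m => ahull (A m)) sAt s
    (projV addA sA kappa U) a.
Proof.
rewrite /fibre_derivative pullback_embedding.
refine (congr1 (@vertical_value R M (fun m => ahull (A m)) sAt (shat a)) _).
rewrite /projV (connector_total_field
  (embedding_hull0 a)) ray_retraction_section -(pushforward_vlift hAt).
apply/funext => g; rewrite /pushforward /on_germs pullback_embedding; case: asboolP =>
  // hg.
rewrite asboolT; last first.
  have hg' : smooth_at sA (rho (iota a)) (fun q => g (shat q)).
    by rewrite ray_retraction_embedding; exact: (hs (p := a) I hg).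
  exact: (ray_retraction_smooth hM hAt (embedding_hull0 a) hg').
by congr (vlift _ _ _ _); apply/funext => q;
  rewrite /= -[in RHS](ray_retraction_embedding hA q).
Qed.

Lemma affine_linearizationE D a : affine_linearization sA sAt kappat D ->
  D U s a = vincl (projT2 a)
      (kappa a (bracket sA (projH addA sA kappa U) (section_vlift addA sA sbar) a))
    + fibre_derivative (E := fun m => ahull (A m)) sAt s (projV addA sA kappa U) a
    + projH addA sA kappa U a e0s *: eval_at (projT2 a).
Proof.
move=> [_ hD].
rewrite (hD U s a _ _ _ hU hs hull0_open (@subset_refl _ _) (embedding_hull0 a)
  total_field pullback_smooth (total_field_embedding a)
    (fun a' _ => pullback_embedding a')).
by rewrite /linearization horizontal_part vertical_part projH_horizontal_lift addrAC.
Qed.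

End Fixed.
End AffineLinearization.

Theorem proposition4p5 (R : realType) (M : Type) (sM : atlas R M)
  (V : M -> lmodType R) (sV : atlas R {m : M & V m})
  (A : forall m, affineSpace (V m)) (sA : atlas R {m : M & A m})
  (sAt : atlas R {m : M & ahull (A m)})
  (hM : manifold sM) (hA : affine_bundle sM sV sA)
  (hAt : canonical_hull sA sAt sM)
  (xiH : {m : M & A m} -> tvector R M -> tvector R {m : M & A m})
  (kappa : forall a : {m : M & A m}, tvector R {m : M & A m} -> V (projT1 a))
  (hxi : connection sM sA setT xiH)
  (hkappa : connector sM (fibre_translate A) sA setT xiH kappa)
  (xit : {m : M & ahull (A m)} -> tvector R M -> tvector R {m : M & ahull (A m)})
  (kappat : forall z : {m : M & ahull (A m)},
     tvector R {m : M & ahull (A m)} -> ahull (A (projT1 z)))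
  (hext : homogeneous_extension sAt sM xiH xit)
  (hxit : connection sM sAt (hull_complement A) xit)
  (hkappat : connector sM (vadd (fun m => ahull (A m))) sAt
     (hull_complement A) xit kappat)
  (D : ({m : M & A m} -> tvector R {m : M & A m}) ->
       (forall a : {m : M & A m}, ahull (A (projT1 a))) ->
       forall a : {m : M & A m}, ahull (A (projT1 a)))
  (hD : affine_linearization sA sAt kappat D)
  (U : {m : M & A m} -> tvector R {m : M & A m}) (hU : vfield sA setT U)
  (s : forall a : {m : M & A m}, ahull (A (projT1 a)))
  (hs : smooth_section sA sAt setT s) :
  let e0s (a : {m : M & A m}) := ahull_height (s a) in
  let PH := projH (fibre_translate A) sA kappa in
  let PV := projV (fibre_translate A) sA kappa in
  exists2 sbar : forall a : {m : M & A m}, V (projT1 a),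
    smooth_section sA sV setT sbar /\
    (forall a : {m : M & A m}, vincl (projT2 a) (sbar a)
               = s a - e0s a *: eval_at (projT2 a)) &
    forall a : {m : M & A m}, D U s a =
      vincl (projT2 a)
        (kappa a (bracket sA (PH U)
           (section_vlift (fibre_translate A) sA sbar) a))
      + fibre_derivative (E := fun m => ahull (A m)) sAt s (PV U) a
      + (PH U a e0s) *: eval_at (projT2 a).
Proof.
move=> e0s PH PV.
exists (vector_part hA s).
  split; first exact: (vector_part_smooth hM (hA := hA) hAt hs).
  exact: (vector_partP hA s).
move=> a; exact: (affine_linearizationE hM hA hAt hxi hkappa hext hxit hkappat hU hs a hD).
Qed.
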